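(* Let $\tilde p:\mathbb{D}\to\mathbb{C}$ be a holomorphic function with $\operatorname{Re}\tilde p\ge 0$. For $k\in\mathbb{R}$ let $\{\psi_t\}_{t\ge 0}$ be the semigroup of holomorphic self-maps of $\mathbb{D}$ defined by $$\frac{d}{dt}\psi_t(z)=(\psi_t(z)-1)^2\,\tilde p(\psi_t(z))-ik\,\psi_t(z),\qquad \psi_0(z)=z,\quad z\in\mathbb{D},\ t\ge 0.$$ If for some $k=k_0\in\mathbb{R}$ this semigroup is a family of automorphisms of $\mathbb{D}$, then $\{\psi_t\}_{t\ge0}$ is a family of automorphisms of $\mathbb{D}$ for all $k\in\mathbb{R}$ (with the same function $\tilde p$).
   Context: $\mathbb{D}$ is the open unit disk in $\mathbb{C}$. For every holomorphic $\tilde p:\mathbb{D}\to\mathbb{C}$ with $\operatorname{Re}\tilde p\ge0$ and every $k\in\mathbb{R}$, the initial value problem in the claim has a unique solution for all $t\ge0$, and $\{\psi_t\}_{t\ge0}$ is a one-parameter continuous semigroup of holomorphic self-maps of $\mathbb{D}$. An automorphism of $\mathbb{D}$ is a biholomorphic self-map of $\mathbb{D}$; the semigroup is a family of automorphisms if every $\psi_t$, $t\ge 0$, is an automorphism. *)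

(* Defs.v *)
From Stdlib Require Import Reals.
From Coquelicot Require Import Coquelicot.

Open Scope R_scope.

Definition unit_disk (z : C) : Prop := Cmod z < 1.

(* The structures are given explicitly because [C] also carries the structure
   of a real normed module, for which [ex_derive] means something else. *)
Definition holomorphic_on (D : C -> Prop) (f : C -> C) : Prop :=
  forall z : C, D z -> @ex_derive C_AbsRing C_NormedModule f z.

Definition disk_automorphism (f : C -> C) : Prop :=
  (forall z : C, unit_disk z -> unit_disk (f z)) /\
  holomorphic_on unit_disk f /\
  exists g : C -> C,
    (forall z : C, unit_disk z -> unit_disk (g z)) /\
    holomorphic_on unit_disk g /\
    (forall z : C, unit_disk z -> g (f z) = z) /\
    (forall z : C, unit_disk z -> f (g z) = z).

(* [u] has derivative [v] at [t] along the half-line [0, +oo): the two-sided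
   derivative for t > 0, the right derivative for t = 0.  This is Coquelicot's
   [is_derive] with the filter [locally t] traced on [0, +oo). *)
Definition is_derive_nonneg (u : R -> C) (t : R) (v : C) : Prop :=
  @filterdiff R_AbsRing R_NormedModule C_R_NormedModule
    u (within (fun s : R => 0 <= s) (locally t))
    (fun h : R => @scal R_AbsRing C_R_NormedModule h v).

Definition vector_field (p : C -> C) (k : R) (w : C) : C :=
  ((w - 1) ^ 2 * p w - Ci * k * w)%C.

(* Only the values [psi t z] with t >= 0 and z in the disk are constrained;
   they must stay in the disk, the domain of the vector field. *)
Definition is_semigroup_of (p : C -> C) (k : R) (psi : R -> C -> C) : Prop :=
  forall z : C, unit_disk z ->
    psi 0 z = z /\
    forall t : R, 0 <= t ->
      unit_disk (psi t z) /\
      is_derive_nonneg (fun s : R => psi s z) t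
        (vector_field p k (psi t z)).

Definition family_of_automorphisms (psi : R -> C -> C) : Prop :=
  forall t : R, 0 <= t -> disk_automorphism (psi t).

(* Main.v *)
Require Import Defs.
From Stdlib Require Import Reals Lra IndefiniteDescription.
From Coquelicot Require Import Coquelicot.

(* By the Schwarz lemma an automorphism [f] preserves the pseudo-hyperbolic
   distance.  Applied to [psi0 t] and differentiated at [t = 0], this says that
   [H z = G z - G 0 + conj (G 0) z^2] satisfies [Re (conj z * H z) = 0], where
   [G] is the vector field for [k0]; the Cauchy-Riemann equations then force
   [H z = i b z] with [b] real.  Passing from [k0] to [k] only changes [b], so
   every vector field of the family is [a - conj a w^2 + i b w], and its
   Riccati flow is an explicit group of Moebius automorphisms of the disk.
   The Schwarz lemma itself is obtained from Goursat's theorem in logarithmic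
   coordinates, which bounds [|f' 0|]; the invariant form of this bound is then
   integrated along a radius. *)

(** * Goursat's theorem on rectangles *)

(** Complex differentiability is only pointwise here, with no continuity of the derivative, so
    bisection takes the place of Green's formula. In logarithmic coordinates a circle about the
    centre becomes a vertical segment and an annulus becomes a rectangle with periodic sides:
    rectangles suffice, and the point 0, where [f z / z] is undefined, recedes to minus infinity. A
    circular mean gives information at the centre only, hence the detour through the derivative at 0
    and its invariant form to bound [f] elsewhere.

    Nothing is known about [psi t z] jointly in [t] and [z]. A quantity conserved along the orbits
    of [0] and [z] asks only for the time derivatives of these two orbits at [t = 0].

    Homogeneity along radii replaces a power series expansion in the passage to [H z = i b z]. No
    existence or uniqueness theorem for differential equations is invoked: for an arbitrary solution
    [w], the inverse Moebius flow applied to [w t] is constant, and this identifies [w]. *)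

Definition flux (u v : R -> R -> R) (x1 x2 y1 y2 : R) : R :=
  RInt (fun y => u x2 y - u x1 y) y1 y2
    - RInt (fun x => v x y2 - v x y1) x1 x2.

(** [flux] is the imaginary part of the contour integral of [u + i v] around the rectangle, formally
    the double integral of [u_x - v_y]. The value [a] occurring twice encodes the Cauchy-Riemann
    equation [u_x = v_y]. *)
Definition divergence_free_on (u v : R -> R -> R) (x1 x2 y1 y2 : R) : Prop :=
  forall x y, x1 <= x <= x2 -> y1 <= y <= y2 ->
    exists a b c,
      differentiable_pt_lim u x y a b /\ differentiable_pt_lim v x y c a.

Lemma differentiable_continuous_r (f : R -> R -> R) (x y a b : R) :
  differentiable_pt_lim f x y a b -> continuous (fun t => f x t) y.
Proof.
intros H.
apply (ex_derive_continuous (K := R_AbsRing) (V := R_NormedModule)).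
exists (a * 0 + b * 1).
apply is_derive_Reals.
apply (derivable_pt_lim_comp_2d f (fun _ => x) (fun t => t)).
- exact H.
- apply is_derive_Reals; apply (is_derive_const (K := R_AbsRing) (V := R_NormedModule)).
- apply is_derive_Reals; apply (is_derive_id (K := R_AbsRing)).
Qed.

Lemma differentiable_continuous_l (f : R -> R -> R) (x y a b : R) :
  differentiable_pt_lim f x y a b -> continuous (fun t => f t y) x.
Proof.
intros H.
apply (ex_derive_continuous (K := R_AbsRing) (V := R_NormedModule)).
exists (a * 1 + b * 0).
apply is_derive_Reals.
apply (derivable_pt_lim_comp_2d f (fun t => t) (fun _ => y)).
- exact H.
- apply is_derive_Reals; apply (is_derive_id (K := R_AbsRing)).
- apply is_derive_Reals; apply (is_derive_const (K := R_AbsRing) (V := R_NormedModule)).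
Qed.

Lemma divergence_free_integrable (u v : R -> R -> R) (x1 x2 y1 y2 : R) :
  divergence_free_on u v x1 x2 y1 y2 ->
  (forall x a b, x1 <= x <= x2 -> y1 <= a -> a <= b -> b <= y2 ->
     ex_RInt (fun y => u x y) a b) /\
  (forall y a b, y1 <= y <= y2 -> x1 <= a -> a <= b -> b <= x2 ->
     ex_RInt (fun x => v x y) a b).
Proof.
intros H; split; intros z a b Hz Ha Hab Hb;
  apply (ex_RInt_continuous (V := R_CompleteNormedModule));
  rewrite Rmin_left, Rmax_right by lra; intros t Ht.
- destruct (H z t) as (da & db & dc & Hu & _); try lra.
  exact (differentiable_continuous_r _ _ _ _ _ Hu).
- destruct (H t z) as (da & db & dc & _ & Hv); try lra.
  exact (differentiable_continuous_l _ _ _ _ _ Hv).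
Qed.

Lemma flux_split (u v : R -> R -> R) (x1 x2 y1 y2 xm ym : R) :
  x1 <= xm <= x2 -> y1 <= ym <= y2 ->
  divergence_free_on u v x1 x2 y1 y2 ->
  flux u v x1 x2 y1 y2 =
    flux u v x1 xm y1 ym + flux u v xm x2 y1 ym
    + flux u v x1 xm ym y2 + flux u v xm x2 ym y2.
Proof.
intros Hx Hy H.
destruct (divergence_free_integrable _ _ _ _ _ _ H) as [Iu Iv].
assert (Du : forall x x' a b, x1 <= x <= x2 -> x1 <= x' <= x2 ->
          y1 <= a -> a <= b -> b <= y2 ->
          RInt (fun y => u x y - u x' y) a b
          = RInt (u x) a b - RInt (u x') a b).
{ intros; apply (RInt_minus (V := R_CompleteNormedModule)); apply Iu; assumption. }
assert (Dv : forall y y' a b, y1 <= y <= y2 -> y1 <= y' <= y2 ->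
          x1 <= a -> a <= b -> b <= x2 ->
          RInt (fun x => v x y - v x y') a b
          = RInt (fun x => v x y) a b - RInt (fun x => v x y') a b).
{ intros; apply (RInt_minus (V := R_CompleteNormedModule) (fun x => v x y) (fun x => v x y'));
    apply Iv; assumption. }
unfold flux.
rewrite !Du, !Dv by lra.
rewrite <- (RInt_Chasles (u x2) y1 ym y2) by (apply Iu; lra).
rewrite <- (RInt_Chasles (u x1) y1 ym y2) by (apply Iu; lra).
rewrite <- (RInt_Chasles (fun x => v x y2) x1 xm x2) by (apply Iv; lra).
rewrite <- (RInt_Chasles (fun x => v x y1) x1 xm x2) by (apply Iv; lra).
unfold plus; simpl; ring.
Qed.

Lemma flux_quarter (u v : R -> R -> R) (x y l m : R) :
  0 <= l -> 0 <= m -> divergence_free_on u v x (x + l) y (y + m) ->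
  exists x' y', x <= x' <= x + l / 2 /\ y <= y' <= y + m / 2 /\
    Rabs (flux u v x (x + l) y (y + m))
    <= 4 * Rabs (flux u v x' (x' + l / 2) y' (y' + m / 2)).
Proof.
intros Hl Hm H.
rewrite (flux_split u v x (x + l) y (y + m) (x + l / 2) (y + m / 2)) by
  (try assumption; lra).
replace (x + l) with (x + l / 2 + l / 2) by field.
replace (y + m) with (y + m / 2 + m / 2) by field.
set (A := flux u v x _ y _). set (B := flux u v _ _ y _).
set (C := flux u v x _ _ _). set (D := flux u v _ _ _ (_ + m / 2)).
assert (T : Rabs (A + B + C + D) <= Rabs A + Rabs B + Rabs C + Rabs D).
{ pose proof (Rabs_triang (A + B + C) D); pose proof (Rabs_triang (A + B) C);
  pose proof (Rabs_triang A B); lra. }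
destruct (Rle_dec (Rabs (A + B + C + D)) (4 * Rabs A)).
{ exists x, y; repeat split; try lra; assumption. }
destruct (Rle_dec (Rabs (A + B + C + D)) (4 * Rabs B)).
{ exists (x + l / 2), y; repeat split; try lra; assumption. }
destruct (Rle_dec (Rabs (A + B + C + D)) (4 * Rabs C)).
{ exists x, (y + m / 2); repeat split; try lra; assumption. }
exists (x + l / 2), (y + m / 2); repeat split; try lra.
fold D; lra.
Qed.

Lemma RInt_close_const (g : R -> R) (k e a b : R) :
  a <= b -> ex_RInt g a b ->
  (forall t, a <= t <= b -> Rabs (g t - k) <= e) ->
  Rabs (RInt g a b - k * (b - a)) <= e * (b - a).
Proof.
intros Hab Ig H.
assert (I2 : is_RInt (fun t => g t - k) a b (RInt g a b - (b - a) * k)).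
{ apply (is_RInt_minus (V := R_NormedModule)).
  - apply (RInt_correct (V := R_CompleteNormedModule)); exact Ig.
  - apply (is_RInt_const (V := R_NormedModule)). }
pose proof (norm_RInt_le_const (V := R_NormedModule)
  (fun t => g t - k) a b _ e Hab H I2) as N.
unfold norm in N; simpl in N; unfold abs in N; simpl in N.
replace (k * (b - a)) with ((b - a) * k) by ring; lra.
Qed.

(** The constant and linear parts of [u] and [v] at [(X, Y)] contribute [a * l * m] to each of the
    two integrals, so they cancel. What remains is an error of at most [e * s] on each of four sides
    of length at most [s]. *)
Lemma flux_small (u v : R -> R -> R) (X Y a b c e d x y l m s : R) :
  0 <= e -> 0 <= l <= s -> 0 <= m <= s -> s < d ->
  x <= X <= x + l -> y <= Y <= y + m ->
  divergence_free_on u v x (x + l) y (y + m) ->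
  (forall x' y', Rabs (x' - X) < d -> Rabs (y' - Y) < d ->
     Rabs (u x' y' - u X Y - (a * (x' - X) + b * (y' - Y)))
       <= e * Rmax (Rabs (x' - X)) (Rabs (y' - Y)) /\
     Rabs (v x' y' - v X Y - (c * (x' - X) + a * (y' - Y)))
       <= e * Rmax (Rabs (x' - X)) (Rabs (y' - Y))) ->
  Rabs (flux u v x (x + l) y (y + m)) <= 4 * e * s ^ 2.
Proof.
intros He Hl Hm Hs HX HY DF H.
destruct (divergence_free_integrable _ _ _ _ _ _ DF) as [Iu Iv].
assert (E : forall x' y', x <= x' <= x + l -> y <= y' <= y + m ->
     Rabs (u x' y' - u X Y - (a * (x' - X) + b * (y' - Y))) <= e * s /\
     Rabs (v x' y' - v X Y - (c * (x' - X) + a * (y' - Y))) <= e * s).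
{ intros x' y' Hx' Hy'.
  assert (Bx : Rabs (x' - X) <= s) by (apply Rabs_le; lra).
  assert (By : Rabs (y' - Y) <= s) by (apply Rabs_le; lra).
  assert (M : e * Rmax (Rabs (x' - X)) (Rabs (y' - Y)) <= e * s).
  { apply Rmult_le_compat_l; [lra | apply Rmax_lub; assumption]. }
  destruct (H x' y'); [lra | lra | split; lra]. }
assert (Bu : Rabs (RInt (fun t => u (x + l) t - u x t) y (y + m)
                   - (a * l) * (y + m - y)) <= (2 * e * s) * (y + m - y)).
{ apply RInt_close_const; [lra | | ].
  - apply (ex_RInt_minus (V := R_NormedModule) (u (x + l)) (u x)); apply Iu; lra.
  - intros t Ht.
    destruct (E (x + l) t) as [E1 _]; try lra.
    destruct (E x t) as [E2 _]; try lra.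
    apply Rabs_le_between in E1; apply Rabs_le_between in E2.
    apply Rabs_le; lra. }
assert (Bv : Rabs (RInt (fun t => v t (y + m) - v t y) x (x + l)
                   - (a * m) * (x + l - x)) <= (2 * e * s) * (x + l - x)).
{ apply RInt_close_const; [lra | | ].
  - apply (ex_RInt_minus (V := R_NormedModule) (fun t => v t (y + m)) (fun t => v t y));
      apply Iv; lra.
  - intros t Ht.
    destruct (E t (y + m)) as [_ E1]; try lra.
    destruct (E t y) as [_ E2]; try lra.
    apply Rabs_le_between in E1; apply Rabs_le_between in E2.
    apply Rabs_le; lra. }
assert (2 * e * s * (y + m - y) <= 2 * e * s ^ 2).
{ replace (2 * e * s ^ 2) with (2 * e * s * s) by ring.
  apply Rmult_le_compat_l; [|lra].
  apply Rmult_le_pos; lra. }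
assert (2 * e * s * (x + l - x) <= 2 * e * s ^ 2).
{ replace (2 * e * s ^ 2) with (2 * e * s * s) by ring.
  apply Rmult_le_compat_l; [|lra].
  apply Rmult_le_pos; lra. }
unfold flux.
apply Rabs_le_between in Bu; apply Rabs_le_between in Bv; apply Rabs_le.
replace (a * l * (y + m - y)) with (a * m * (x + l - x)) in Bu by ring.
lra.
Qed.

Lemma dependent_choice_seq {A : Type} (P : nat -> A -> Prop)
  (Q : nat -> A -> A -> Prop) (a0 : A) :
  P O a0 ->
  (forall n a, P n a -> exists b, P (S n) b /\ Q n a b) ->
  exists s : nat -> A,
    s O = a0 /\ forall n, P n (s n) /\ Q n (s n) (s (S n)).
Proof.
intros H0 HS.
(* The chosen successor is packed with its proof of [Q], so that the relation between consecutive
   terms can be read off the same choice. *)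
set (next := fun n (p : {a | P n a}) =>
  let (b, Hb) := constructive_indefinite_description _
    (HS n (proj1_sig p) (proj2_sig p)) in
  exist (fun q => Q n (proj1_sig p) (proj1_sig q))
    (exist (P (S n)) b (proj1 Hb)) (proj2 Hb)).
set (s := fix s n : {a | P n a} :=
  match n with
  | O => exist _ a0 H0
  | S n => proj1_sig (next n (s n))
  end).
exists (fun n => proj1_sig (s n)); split; [reflexivity|].
intros n; split; [exact (proj2_sig (s n))|].
exact (proj2_sig (next n (s n))).
Qed.

Lemma nested_intervals (a : nat -> R) (l : R) :
  (forall n, a n <= a (S n) <= a n + l / 2 ^ n / 2) ->
  exists z, forall n, a n <= z <= a n + l / 2 ^ n.
Proof.
intros H.
assert (Hr : forall n, a (S n) + l / 2 ^ S n <= a n + l / 2 ^ n).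
{ intros n; destruct (H n) as [_ H2].
  replace (l / 2 ^ S n) with (l / 2 ^ n / 2)
    by (simpl; field; apply pow_nonzero; lra).
  lra. }
assert (Hm : forall n k, a n <= a (n + k)%nat).
{ intros n k; induction k as [|k IH].
  - rewrite Nat.add_0_r; lra.
  - rewrite Nat.add_succ_r; destruct (H (n + k)%nat); lra. }
assert (Hd : forall n k, a (n + k)%nat + l / 2 ^ (n + k) <= a n + l / 2 ^ n).
{ intros n k; induction k as [|k IH].
  - rewrite Nat.add_0_r; lra.
  - rewrite Nat.add_succ_r; pose proof (Hr (n + k)%nat); lra. }
assert (Hp : forall n, 0 <= l / 2 ^ n).
{ intros n; destruct (H n); lra. }
destruct (ex_finite_lim_seq_incr a (a O + l / 2 ^ O)) as [z Hz].
{ intros n; apply H. }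
{ intros n; pose proof (Hd O n); pose proof (Hp n); simpl in *; lra. }
exists z; intros n.
apply (is_lim_seq_incr_n a n) in Hz.
split.
- apply (is_lim_seq_le (fun _ => a n) (fun k => a (k + n)%nat) (a n) z);
    [| apply is_lim_seq_const | exact Hz].
  intros k; rewrite Nat.add_comm; apply Hm.
- apply (is_lim_seq_le (fun k => a (k + n)%nat) (fun _ => a n + l / 2 ^ n)
    z (a n + l / 2 ^ n)); [| exact Hz | apply is_lim_seq_const].
  intros k; rewrite Nat.add_comm.
  pose proof (Hd n k); pose proof (Hp (n + k)%nat); lra.
Qed.

(* Goursat's bisection argument: no continuity of the partial derivatives is
   needed. *)
Lemma flux_zero (u v : R -> R -> R) (x y l m : R) :
  0 <= l -> 0 <= m -> divergence_free_on u v x (x + l) y (y + m) ->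
  flux u v x (x + l) y (y + m) = 0.
Proof.
intros Hl Hm DF.
set (F := flux u v x (x + l) y (y + m)).
assert (P2 : forall n, 0 < 2 ^ n) by (intros; apply pow_lt; lra).
destruct (dependent_choice_seq
  (fun n p => x <= fst p /\ fst p + l / 2 ^ n <= x + l /\
    y <= snd p /\ snd p + m / 2 ^ n <= y + m /\
    Rabs F <= 4 ^ n * Rabs (flux u v (fst p) (fst p + l / 2 ^ n)
                              (snd p) (snd p + m / 2 ^ n)))
  (fun n p q => fst p <= fst q <= fst p + l / 2 ^ n / 2 /\
    snd p <= snd q <= snd p + m / 2 ^ n / 2) (x, y)) as (s & _ & Hs).
{ simpl; rewrite !Rdiv_1_r; repeat split; try lra.
  fold F; lra. }
{ intros n [x0 y0]; simpl fst; simpl snd; intros (H1 & H2 & H3 & H4 & H5).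
  destruct (flux_quarter u v x0 y0 (l / 2 ^ n) (m / 2 ^ n))
    as (x' & y' & Hx' & Hy' & HF).
  - apply Rdiv_le_0_compat; auto.
  - apply Rdiv_le_0_compat; auto.
  - intros t t' Ht Ht'; apply DF; lra.
  - exists (x', y'); simpl fst; simpl snd.
    replace (l / 2 ^ S n) with (l / 2 ^ n / 2) by
      (simpl; field; specialize (P2 n); lra).
    replace (m / 2 ^ S n) with (m / 2 ^ n / 2) by
      (simpl; field; specialize (P2 n); lra).
    repeat split; try lra.
    apply Rle_trans with (1 := H5).
    replace (4 ^ S n) with (4 ^ n * 4) by (simpl; ring).
    rewrite Rmult_assoc; apply Rmult_le_compat_l; [|exact HF].
    apply pow_le; lra. }
destruct (nested_intervals (fun n => fst (s n)) l) as [X HX].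
{ intros n; apply Hs. }
destruct (nested_intervals (fun n => snd (s n)) m) as [Y HY].
{ intros n; apply Hs. }
destruct (DF X Y) as (a & b & c & Du & Dv).
{ destruct (Hs O) as [(H1 & H2 & _) _]; specialize (HX O); lra. }
{ destruct (Hs O) as [(_ & _ & H1 & H2 & _) _]; specialize (HY O); lra. }
set (s0 := Rmax l m).
assert (S0 : 0 <= s0) by (apply Rle_trans with (1 := Hl); apply Rmax_l).
assert (B : forall eps : posreal, Rabs F <= eps * (4 * s0 ^ 2)).
{ intros eps.
  destruct (Du eps) as [d1 Hd1]; destruct (Dv eps) as [d2 Hd2].
  set (d := Rmin d1 d2).
  assert (Hd : 0 < d) by (apply Rmin_pos; apply cond_pos).
  (* Since [s0 / d < n + 1 <= 2 ^ (n + 1)], the rectangle of generation [n + 1] lies within the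
     distance [d] of [(X, Y)] on which both first-order expansions hold. *)
  destruct (nfloor_ex (s0 / d)) as [n Hn].
  { apply Rdiv_le_0_compat; assumption. }
  assert (Hsn : s0 / 2 ^ S n < d).
  { apply Rmult_lt_reg_r with (2 ^ S n); [apply P2|].
    replace (s0 / 2 ^ S n * 2 ^ S n) with (s0 / d * d) by
      (field; split; apply Rgt_not_eq; [apply P2 | exact Hd]).
    rewrite Rmult_comm; apply Rmult_lt_compat_l; [exact Hd|].
    apply Rlt_le_trans with (1 := proj2 Hn).
    replace (INR n + 1) with (INR (S n)) by (rewrite S_INR; ring).
    apply Rlt_le; clear; induction (S n) as [|k IH]; [simpl; lra|].
    rewrite S_INR; simpl.
    assert (1 <= 2 ^ k) by (apply pow_R1_Rle; lra).
    lra. }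
  destruct (Hs (S n)) as [(H1 & H2 & H3 & H4 & H5) _].
  apply Rle_trans with (1 := H5).
  (* The factor [4 ^ S n] lost in the bisections is exactly regained from the squared side length,
     so the bound does not depend on [n]. *)
  replace (eps * (4 * s0 ^ 2))
    with (4 ^ S n * (4 * eps * (s0 / 2 ^ S n) ^ 2)).
  2: { replace 4 with (2 ^ 2) at 1 by ring.
       rewrite <- pow_mult, Nat.mul_comm, pow_mult.
       field; apply Rgt_not_eq, P2. }
  apply Rmult_le_compat_l; [apply pow_le; lra|].
  assert (Q : forall t, 0 <= t -> 0 <= t / 2 ^ S n)
    by (intros; apply Rdiv_le_0_compat; auto).
  assert (Q' : forall t, t <= s0 -> t / 2 ^ S n <= s0 / 2 ^ S n).
  { intros t Ht; apply Rmult_le_compat_r; [|exact Ht].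
    apply Rlt_le, Rinv_0_lt_compat, P2. }
  apply (flux_small u v X Y a b c eps d).
  - apply Rlt_le, cond_pos.
  - split; [apply Q, Hl | apply Q', Rmax_l].
  - split; [apply Q, Hm | apply Q', Rmax_r].
  - exact Hsn.
  - apply HX.
  - apply HY.
  - intros t t' Ht Ht'; apply DF; lra.
  - intros x' y' Hx' Hy'; split.
    + apply Hd1; [apply Rlt_le_trans with (1 := Hx') |
                  apply Rlt_le_trans with (1 := Hy')]; apply Rmin_l.
    + apply Hd2; [apply Rlt_le_trans with (1 := Hx') |
                  apply Rlt_le_trans with (1 := Hy')]; apply Rmin_r. }
destruct (Req_dec F 0) as [|NZ]; [assumption|exfalso].
pose proof (Rabs_pos_lt F NZ) as FP.
(* The bound [B] is used with [eps = Rabs F / (4 * s0 ^ 2 + 1)]; the added 1 keeps the divisor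
   positive for a degenerate rectangle. *)
assert (K : 0 < 4 * s0 ^ 2 + 1) by (pose proof (pow2_ge_0 s0); lra).
pose proof (B (mkposreal _ (Rdiv_lt_0_compat _ _ FP K))) as B'.
simpl in B'.
assert (Rabs F * (4 * s0 ^ 2 + 1) <= Rabs F * (4 * s0 ^ 2)).
{ apply Rmult_le_compat_r with (r := 4 * s0 ^ 2 + 1) in B'; [|lra].
  apply Rle_trans with (1 := B'); right; field; lra. }
lra.
Qed.

(** * Complex derivatives *)

Definition is_cderive (f : C -> C) (z d : C) : Prop :=
  @is_derive C_AbsRing C_NormedModule f z d.

Lemma is_cderive_iff (f : C -> C) (z d : C) :
  is_cderive f z d <->
  forall eps : posreal, exists delta : posreal, forall w,
    Cmod (w - z) < delta ->
    Cmod (f w - f z - (w - z) * d) <= eps * Cmod (w - z).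
Proof.
split.
- intros [_ H] eps.
  destruct (H z (fun P HP => HP) eps) as [delta Hd].
  exists delta; intros w Hw; exact (Hd w Hw).
- intros H; split.
  + exact (is_linear_scal_l (K := C_AbsRing) (V := C_NormedModule) d).
  + intros x Hx eps.
    assert (E : z = x) by exact (is_filter_lim_locally_unique
      (K := C_AbsRing) (V := AbsRing_NormedModule C_AbsRing) z x Hx).
    subst x.
    destruct (H eps) as [delta Hd].
    exists delta; intros w Hw; exact (Hd w Hw).
Qed.

(** The product rule, and the inner function in the chain rule, ask for the structure of [C] as a
    ring over itself. Both structures give the same estimate, so only the linearity clause has to be
    rebuilt. *)
Lemma is_cderive_AbsRing (f : C -> C) (z d : C) :
  is_cderive f z d <->
  @is_derive C_AbsRing (AbsRing_NormedModule C_AbsRing) f z d.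
Proof.
split; intros [_ H]; split.
- exact (is_linear_scal_l (K := C_AbsRing)
    (V := AbsRing_NormedModule C_AbsRing) d).
- exact H.
- exact (is_linear_scal_l (K := C_AbsRing) (V := C_NormedModule) d).
- exact H.
Qed.

Lemma is_cderive_comp (f g : C -> C) (z df dg : C) :
  is_cderive f (g z) df -> is_cderive g z dg ->
  is_cderive (fun w => f (g w)) z (dg * df).
Proof.
intros Hf Hg.
apply (is_derive_comp (K := C_AbsRing) (V := C_NormedModule)).
- exact Hf.
- apply is_cderive_AbsRing, Hg.
Qed.

Lemma is_cderive_mult (f g : C -> C) (z df dg : C) :
  is_cderive f z df -> is_cderive g z dg ->
  is_cderive (fun w => f w * g w)%C z (df * g z + f z * dg).
Proof.
intros Hf Hg; apply is_cderive_AbsRing.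
apply (is_derive_mult (K := C_AbsRing)).
- apply is_cderive_AbsRing, Hf.
- apply is_cderive_AbsRing, Hg.
- exact Cmult_comm.
Qed.

Lemma is_cderive_plus (f g : C -> C) (z df dg : C) :
  is_cderive f z df -> is_cderive g z dg ->
  is_cderive (fun w => f w + g w)%C z (df + dg).
Proof. apply (is_derive_plus (K := C_AbsRing) (V := C_NormedModule)). Qed.

Lemma is_cderive_const (a z : C) : is_cderive (fun _ => a) z 0.
Proof. apply (is_derive_const (K := C_AbsRing) (V := C_NormedModule)). Qed.

Lemma is_cderive_id (z : C) : is_cderive (fun w => w) z 1.
Proof.
apply is_cderive_AbsRing, (is_derive_id (K := C_AbsRing)).
Qed.

Lemma is_cderive_Re_Im (f : C -> C) (x y : R) (d : C) :
  is_cderive f (x, y) d ->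
  differentiable_pt_lim (fun s t => Re (f (s, t))) x y (Re d) (- Im d) /\
  differentiable_pt_lim (fun s t => Im (f (s, t))) x y (Im d) (Re d).
Proof.
intros H; rewrite is_cderive_iff in H.
(* [differentiable_pt_lim] measures increments by the maximum of the coordinates, and [Cmod] is at
   most [sqrt 2] times that; hence both [eps] and [delta] are divided by [sqrt 2]. *)
assert (S2 : 0 < sqrt 2) by (apply sqrt_lt_R0; lra).
assert (K : forall eps : posreal, locally_2d (fun s t =>
  Cmod (f (s, t) - f (x, y) - ((s, t) - (x, y)) * d)
  <= eps * Rmax (Rabs (s - x)) (Rabs (t - y))) x y).
{ intros eps.
  destruct (H (mkposreal _ (Rdiv_lt_0_compat _ _ (cond_pos eps) S2)))
    as [delta Hd].
  exists (mkposreal _ (Rdiv_lt_0_compat _ _ (cond_pos delta) S2)).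
  intros s t Hs Ht; simpl in Hs, Ht.
  set (M := Rmax (Rabs (s - x)) (Rabs (t - y))).
  assert (HM : Cmod ((s, t) - (x, y)) <= sqrt 2 * M).
  { exact (Cmod_2Rmax ((s, t) - (x, y))%C). }
  assert (HM' : sqrt 2 * M < delta).
  { apply Rmult_lt_reg_r with (/ sqrt 2); [apply Rinv_0_lt_compat, S2|].
    replace (sqrt 2 * M * / sqrt 2) with M by (field; lra).
    apply Rmax_lub_lt; assumption. }
  eapply Rle_trans; [apply Hd; lra|].
  simpl.
  replace (eps * M) with (eps / sqrt 2 * (sqrt 2 * M)) by (field; lra).
  apply Rmult_le_compat_l; [|exact HM].
  apply Rlt_le, Rdiv_lt_0_compat; [apply cond_pos | exact S2]. }
split; intros eps; destruct (K eps) as [delta Hd];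
  exists delta; intros s t Hs Ht; eapply Rle_trans;
  [| apply (Hd s t Hs Ht) | | apply (Hd s t Hs Ht)];
  eapply Rle_trans; [| apply Rmax_Cmod | | apply Rmax_Cmod].
- eapply Rle_trans; [|apply Rmax_l].
  right; f_equal; unfold Re, Im; simpl; ring.
- eapply Rle_trans; [|apply Rmax_r].
  right; f_equal; unfold Re, Im; simpl; ring.
Qed.

Lemma holomorphic_cderive (D : C -> Prop) (f : C -> C) (z : C) :
  holomorphic_on D f -> D z -> exists d, is_cderive f z d.
Proof. intros H Dz; exact (H z Dz). Qed.

Lemma is_cderive_ext (f g : C -> C) (z d : C) (r : R) :
  0 < r -> (forall w, Cmod (w - z) < r -> f w = g w) ->
  is_cderive f z d -> is_cderive g z d.
Proof.
intros Hr E H.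
apply is_cderive_iff; intros eps.
rewrite is_cderive_iff in H.
destruct (H eps) as [delta Hd].
exists (mkposreal _ (Rmin_pos _ _ (cond_pos delta) Hr)); simpl; intros w Hw.
rewrite <- !E.
- apply Hd, Rlt_le_trans with (1 := Hw), Rmin_l.
- replace (z - z)%C with (RtoC 0) by ring; rewrite Cmod_0; exact Hr.
- apply Rlt_le_trans with (1 := Hw), Rmin_r.
Qed.

(** * The Schwarz lemma at the centre *)

Lemma differentiable_pt_lim_mult (f g : R -> R -> R) (x y fx fy gx gy : R) :
  differentiable_pt_lim f x y fx fy -> differentiable_pt_lim g x y gx gy ->
  differentiable_pt_lim (fun s t => f s t * g s t) x y
    (fx * g x y + f x y * gx) (fy * g x y + f x y * gy).
Proof.
intros Hf Hg.
replace (fx * g x y + f x y * gx) with (g x y * fx + f x y * gx) by ring.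
replace (fy * g x y + f x y * gy) with (g x y * fy + f x y * gy) by ring.
apply (differentiable_pt_lim_comp Rmult); [|assumption|assumption].
intros eps; exists eps; intros s t Hs Ht.
replace (s * t - f x y * g x y
         - (g x y * (s - f x y) + f x y * (t - g x y)))
  with ((s - f x y) * (t - g x y)) by ring.
rewrite Rabs_mult.
apply Rmult_le_compat; try apply Rabs_pos; [lra | apply Rmax_r].
Qed.

Lemma differentiable_pt_lim_plus (f g : R -> R -> R) (x y fx fy gx gy : R) :
  differentiable_pt_lim f x y fx fy -> differentiable_pt_lim g x y gx gy ->
  differentiable_pt_lim (fun s t => f s t + g s t) x y (fx + gx) (fy + gy).
Proof.
intros Hf Hg.
replace (fx + gx) with (1 * fx + 1 * gx) by ring.
replace (fy + gy) with (1 * fy + 1 * gy) by ring.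
apply (differentiable_pt_lim_comp Rplus); [|assumption|assumption].
intros eps; exists eps; intros s t _ _.
replace (s + t - (f x y + g x y) - (1 * (s - f x y) + 1 * (t - g x y)))
  with 0 by ring.
rewrite Rabs_R0; apply Rmult_le_pos; [apply Rlt_le, cond_pos|].
apply Rle_trans with (2 := Rmax_l _ _), Rabs_pos.
Qed.

Lemma differentiable_pt_lim_fst (f : R -> R) (x y l : R) :
  is_derive f x l -> differentiable_pt_lim (fun s _ => f s) x y l 0.
Proof.
intros H; apply differentiable_pt_lim_proj1_0, is_derive_Reals, H.
Qed.

Lemma differentiable_pt_lim_snd (f : R -> R) (x y l : R) :
  is_derive f y l -> differentiable_pt_lim (fun _ t => f t) x y 0 l.
Proof.
intros H.
apply (fun p => differentiable_pt_lim_fst f y x l p) in H.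
intros eps; destruct (H eps) as [delta Hd].
exists delta; intros s t Hs Ht.
rewrite Rmax_comm, (Rplus_comm (0 * _)).
apply (Hd t s Ht Hs).
Qed.

(* With [E = exp (x + i t)], [polar_re] and [polar_im] are the real and
   imaginary parts of [f E / E], a holomorphic function of [x + i t]. *)
Definition cpolar (x t : R) : C := (exp x * cos t, exp x * sin t).

Definition polar_re (f : C -> C) (x t : R) : R :=
  exp (- x) * (Re (f (cpolar x t)) * cos t + Im (f (cpolar x t)) * sin t).

Definition polar_im (f : C -> C) (x t : R) : R :=
  exp (- x) * (Im (f (cpolar x t)) * cos t + - sin t * Re (f (cpolar x t))).

Lemma Cmod_cpolar (x t : R) : Cmod (cpolar x t) = exp x.
Proof.
unfold Cmod, cpolar; simpl.
replace (exp x * cos t * (exp x * cos t * 1)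
         + exp x * sin t * (exp x * sin t * 1)) with (exp x ^ 2).
- apply sqrt_pow2, Rlt_le, exp_pos.
- pose proof (sin2_cos2 t) as T; unfold Rsqr in T.
  replace (exp x ^ 2) with (exp x ^ 2 * (sin t * sin t + cos t * cos t))
    by (rewrite T; ring).
  ring.
Qed.

(** This is one Cauchy-Riemann equation for [f E / E] as a function of [x + i t]; [x2 < 0] keeps [E]
    inside the disk. The partial derivatives are assembled by the chain and product rules, and their
    equality is then a ring identity. *)
Lemma polar_divergence_free (f : C -> C) (x1 x2 y1 y2 : R) :
  holomorphic_on unit_disk f -> x2 < 0 ->
  divergence_free_on (polar_re f) (polar_im f) x1 x2 y1 y2.
Proof.
intros Hf Hx2 x t Hx _.
destruct (holomorphic_cderive _ f (cpolar x t) Hf) as [d Hd].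
{ unfold unit_disk; rewrite Cmod_cpolar, <- exp_0; apply exp_increasing; lra. }
destruct (is_cderive_Re_Im f (exp x * cos t) (exp x * sin t) d Hd)
  as [HA HB].
assert (HX : differentiable_pt_lim (fun s t => exp s * cos t) x t
          (exp x * cos t + exp x * 0) (0 * cos t + exp x * - sin t)).
{ apply (differentiable_pt_lim_mult (fun s _ => exp s) (fun _ t => cos t)).
  - apply differentiable_pt_lim_fst, is_derive_exp.
  - apply differentiable_pt_lim_snd, is_derive_cos. }
assert (HY : differentiable_pt_lim (fun s t => exp s * sin t) x t
          (exp x * sin t + exp x * 0) (0 * sin t + exp x * cos t)).
{ apply (differentiable_pt_lim_mult (fun s _ => exp s) (fun _ t => sin t)).
  - apply differentiable_pt_lim_fst, is_derive_exp.
  - apply differentiable_pt_lim_snd, is_derive_sin. }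
pose proof (differentiable_pt_lim_comp _ _ _ _ _ _ _ _ _ _ _ HA HX HY) as HA'.
pose proof (differentiable_pt_lim_comp _ _ _ _ _ _ _ _ _ _ _ HB HX HY) as HB'.
assert (HE : differentiable_pt_lim (fun s _ => exp (- s)) x t (- exp (- x)) 0).
{ apply differentiable_pt_lim_fst; auto_derive; [exact I | ring]. }
assert (HC : differentiable_pt_lim (fun _ t => cos t) x t 0 (- sin t)).
{ apply differentiable_pt_lim_snd, is_derive_cos. }
assert (HS : differentiable_pt_lim (fun _ t => sin t) x t 0 (cos t)).
{ apply differentiable_pt_lim_snd, is_derive_sin. }
assert (HS' : differentiable_pt_lim (fun _ t => - sin t) x t 0 (- cos t)).
{ apply differentiable_pt_lim_snd; auto_derive; [exact I | ring]. }
pose proof (differentiable_pt_lim_mult _ _ _ _ _ _ _ _ HE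
  (differentiable_pt_lim_plus _ _ _ _ _ _ _ _
    (differentiable_pt_lim_mult _ _ _ _ _ _ _ _ HA' HC)
    (differentiable_pt_lim_mult _ _ _ _ _ _ _ _ HB' HS))) as HU.
pose proof (differentiable_pt_lim_mult _ _ _ _ _ _ _ _ HE
  (differentiable_pt_lim_plus _ _ _ _ _ _ _ _
    (differentiable_pt_lim_mult _ _ _ _ _ _ _ _ HB' HC)
    (differentiable_pt_lim_mult _ _ _ _ _ _ _ _ HS' HA'))) as HV.
cbv beta in HU, HV.
eexists; eexists; eexists; split; [exact HU|].
match type of HV with differentiable_pt_lim _ _ _ _ ?p =>
  match goal with |- differentiable_pt_lim _ _ _ _ ?q =>
    replace q with p by ring end end.
exact HV.
Qed.

(** The rectangle is an annulus cut along a ray. Its two horizontal sides are the two lips of the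
    cut and cancel by periodicity, so zero flux equates the integrals over the two vertical
    sides. *)
Lemma RInt_polar_re_const (f : C -> C) (a b : R) :
  holomorphic_on unit_disk f -> a <= b -> b < 0 ->
  ex_RInt (polar_re f a) 0 (2 * PI) /\ ex_RInt (polar_re f b) 0 (2 * PI) /\
  RInt (polar_re f a) 0 (2 * PI) = RInt (polar_re f b) 0 (2 * PI).
Proof.
intros Hf Hab Hb.
pose proof PI_RGT_0 as HPI.
pose proof (polar_divergence_free f a b 0 (2 * PI) Hf Hb) as DF.
destruct (divergence_free_integrable _ _ _ _ _ _ DF) as [I _].
assert (Ia : ex_RInt (polar_re f a) 0 (2 * PI)) by (apply I; lra).
assert (Ib : ex_RInt (polar_re f b) 0 (2 * PI)) by (apply I; lra).
split; [exact Ia|]; split; [exact Ib|].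
pose proof (flux_zero (polar_re f) (polar_im f) a 0 (b - a) (2 * PI)) as F.
replace (a + (b - a)) with b in F by ring.
rewrite Rplus_0_l in F.
specialize (F ltac:(lra) ltac:(lra) DF); unfold flux in F.
rewrite (RInt_ext (fun x => polar_im f x (2 * PI) - polar_im f x 0)
           (fun _ => 0)) in F.
2: { intros x _; change (polar_im f x (2 * PI) - polar_im f x 0 = 0).
     unfold polar_im, cpolar.
     rewrite cos_2PI, sin_2PI, cos_0, sin_0; ring. }
rewrite (RInt_const (V := R_CompleteNormedModule)) in F.
pose proof (RInt_minus (V := R_CompleteNormedModule) (polar_re f b)
  (polar_re f a) 0 (2 * PI) Ib Ia) as M.
change (RInt (fun y => polar_re f b y - polar_re f a y) 0 (2 * PI)
  = RInt (polar_re f b) 0 (2 * PI) - RInt (polar_re f a) 0 (2 * PI)) in M.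
rewrite M in F.
unfold scal in F; simpl in F; unfold mult in F;
  simpl in F; lra.
Qed.

Lemma Re_rotate_le_Cmod (w : C) (t : R) :
  Rabs (Re w * cos t + Im w * sin t) <= Cmod w.
Proof.
replace (Re w * cos t + Im w * sin t) with (Re (w * (cos t, (- sin t)%R))%C)
  by (unfold Re, Im; simpl; ring).
eapply Rle_trans; [apply re_le_Cmod|].
rewrite Cmod_mult.
replace (Cmod (cos t, - sin t)) with 1; [right; ring|].
unfold Cmod; simpl.
replace (cos t * (cos t * 1) + - sin t * (- sin t * 1)) with 1;
  [symmetry; apply sqrt_1|].
pose proof (sin2_cos2 t) as T; unfold Rsqr in T; lra.
Qed.

(* The circular mean of [f z / z] does not depend on the radius: it tends to
   [d] at the centre and is bounded by [1] at the boundary. *)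
Lemma schwarz_Re_derivative (f : C -> C) (d : C) :
  holomorphic_on unit_disk f ->
  (forall z, unit_disk z -> Cmod (f z) <= 1) ->
  f 0 = 0 -> is_cderive f 0 d -> Re d <= 1.
Proof.
intros Hf B f0 Hd.
apply Rnot_lt_le; intros Hgt.
(* The mean will be at least [Re d - e] and at most [1 + e], which is contradictory as soon as
   [2 * e < Re d - 1]. *)
set (e := (Re d - 1) / 4).
assert (He : 0 < e) by (unfold e; lra).
rewrite is_cderive_iff in Hd.
destruct (Hd (mkposreal e He)) as [delta Hdelta]; simpl in Hdelta.
(* The outer circle has radius [1 / (1 + e)], where [Cmod (f z) <= 1] bounds [f z / z] by [1 + e].
   The inner radius [exp a] is then taken below both this radius and [delta]. *)
set (b := - ln (1 + e)).
assert (Hb : b < 0).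
{ assert (ln 1 < ln (1 + e)) by (apply ln_increasing; lra).
  rewrite ln_1 in H; unfold b; lra. }
set (a := Rmin b (ln delta - 1)).
assert (Hab : a <= b) by apply Rmin_l.
assert (Had : exp a < delta).
{ apply Rle_lt_trans with (exp (ln delta - 1)).
  - destruct (Rmin_r b (ln delta - 1)) as [H|H]; fold a in H.
    + apply Rlt_le, exp_increasing, H.
    + rewrite H; lra.
  - apply Rlt_le_trans with (exp (ln delta)).
    + apply exp_increasing; lra.
    + rewrite exp_ln; [lra | apply cond_pos]. }
destruct (RInt_polar_re_const f a b Hf Hab Hb) as (Ia & Ib & E).
pose proof PI_RGT_0 as HPI.
assert (Lo : RInt (fun _ => Re d - e) 0 (2 * PI)
             <= RInt (polar_re f a) 0 (2 * PI)).
{ apply RInt_le; [lra | apply ex_RInt_const | exact Ia |].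
  intros t _.
  set (z := cpolar a t).
  assert (Hz : Cmod (z - 0) = exp a).
  { replace (z - 0)%C with z by ring; apply Cmod_cpolar. }
  specialize (Hdelta z); rewrite Hz in Hdelta.
  specialize (Hdelta Had).
  set (r := (f z - f 0 - (z - 0) * d)%C) in Hdelta.
  assert (Ef : f z = (r + z * d)%C) by (unfold r; rewrite f0; ring).
  unfold polar_re; fold z; rewrite Ef.
  pose proof (Re_rotate_le_Cmod r t) as Hr.
  assert (Hr' : - (e * exp a) <= Re r * cos t + Im r * sin t).
  { apply Rabs_le_between in Hr; lra. }
  replace (exp (- a) * (Re (r + z * d) * cos t + Im (r + z * d) * sin t))
    with (exp (- a) * (Re r * cos t + Im r * sin t)
          + (exp (- a) * exp a) * ((sin t)² + (cos t)²) * Re d).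
  2: { unfold z, cpolar, Re, Im, Rsqr; simpl; ring. }
  rewrite sin2_cos2, <- exp_plus.
  replace (- a + a) with 0 by ring; rewrite exp_0.
  apply Rmult_le_compat_l with (r := exp (- a)) in Hr';
    [|apply Rlt_le, exp_pos].
  replace (exp (- a) * - (e * exp a)) with (- e * (exp (- a) * exp a)) in Hr'
    by ring.
  rewrite <- exp_plus in Hr'.
  replace (- a + a) with 0 in Hr' by ring; rewrite exp_0 in Hr'; lra. }
assert (Up : RInt (polar_re f b) 0 (2 * PI)
             <= RInt (fun _ => 1 + e) 0 (2 * PI)).
{ apply RInt_le; [lra | exact Ib | apply ex_RInt_const |].
  intros t _; unfold polar_re.
  assert (Eb : exp (- b) = 1 + e).
  { unfold b; rewrite Ropp_involutive; apply exp_ln; lra. }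
  rewrite Eb.
  set (w := f (cpolar b t)).
  assert (Hw : Cmod w <= 1).
  { apply B; unfold unit_disk; rewrite Cmod_cpolar, <- exp_0.
    apply exp_increasing, Hb. }
  pose proof (Re_rotate_le_Cmod w t) as Hr.
  apply Rabs_le_between in Hr.
  rewrite <- (Rmult_1_r (1 + e)) at 2.
  apply Rmult_le_compat_l; lra. }
rewrite (RInt_const (V := R_CompleteNormedModule)) in Lo.
rewrite (RInt_const (V := R_CompleteNormedModule)) in Up.
unfold scal in Lo, Up; simpl in Lo, Up; unfold mult in Lo, Up;
  simpl in Lo, Up.
assert (H : (2 * PI - 0) * (Re d - e) <= (2 * PI - 0) * (1 + e)) by lra.
apply Rmult_le_reg_l in H; unfold e in *; lra.
Qed.

Lemma Cmod_phase (d : C) :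
  d <> 0 -> exists l : C, Cmod l = 1 /\ (l * d)%C = Cmod d.
Proof.
intros NZ.
assert (P : 0 < Cmod d) by (apply Cmod_gt_0, NZ).
assert (Pc : RtoC (Cmod d) <> 0) by (intros H; apply RtoC_inj in H; lra).
exists (Cconj d / Cmod d)%C; split.
- rewrite Cmod_div, Cmod_conj, Cmod_R, Rabs_pos_eq by (assumption || lra).
  apply Rinv_r; lra.
- replace (Cconj d / Cmod d * d)%C with (d * Cconj d / Cmod d)%C
    by (field; exact Pc).
  rewrite <- Cmod2_conj; simpl; rewrite Rmult_1_r, RtoC_mult.
  field; exact Pc.
Qed.

Lemma schwarz_derivative (f : C -> C) (d : C) :
  holomorphic_on unit_disk f ->
  (forall z, unit_disk z -> Cmod (f z) <= 1) ->
  f 0 = 0 -> is_cderive f 0 d -> Cmod d <= 1.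
Proof.
intros Hf B f0 Hd.
destruct (Ceq_dec d 0) as [E|NZ].
{ rewrite E, Cmod_0; lra. }
destruct (Cmod_phase d NZ) as (l & Hl & Hld).
assert (M : forall z g, is_cderive f z g ->
              is_cderive (fun w => l * f w)%C z (l * g)).
{ intros z g Hg.
  replace (l * g)%C with (0 * f z + l * g)%C by ring.
  apply (is_cderive_mult (fun _ => l)); [apply is_cderive_const | exact Hg]. }
change (Cmod d) with (Re (Cmod d)); rewrite <- Hld.
apply (schwarz_Re_derivative (fun w => l * f w)%C).
- intros z Hz.
  destruct (holomorphic_cderive _ f z Hf Hz) as [g Hg].
  exists (l * g)%C; exact (M z g Hg).
- intros z Hz; rewrite Cmod_mult, Hl, Rmult_1_l; apply B, Hz.
- rewrite f0; ring.
- apply M, Hd.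
Qed.

(** * Moebius maps and the Schwarz-Pick lemma *)

Lemma is_cderive_inv (z : C) : z <> 0 -> is_cderive Cinv z (- / (z * z)).
Proof.
intros NZ; apply is_cderive_iff; intros eps.
assert (P : 0 < Cmod z) by (apply Cmod_gt_0, NZ).
(* The remainder is [(w - z) ^ 2 / (w * z ^ 2)]. Once [Cmod w > Cmod z / 2], it is at most
   [2 * h ^ 2 / Cmod z ^ 3] with [h = Cmod (w - z)], whence this threshold for [h]. *)
assert (P3 : 0 < eps * Cmod z ^ 3 / 2).
{ apply Rdiv_lt_0_compat; [|lra].
  apply Rmult_lt_0_compat; [apply cond_pos | apply pow_lt, P]. }
assert (P2 : 0 < Cmod z / 2) by lra.
exists (mkposreal _ (Rmin_pos _ _ P2 P3)); simpl; intros w Hw.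
set (h := Cmod (w - z)) in *.
assert (H2 : h < Cmod z / 2) by apply Rlt_le_trans with (1 := Hw), Rmin_l.
assert (H3 : h < eps * Cmod z ^ 3 / 2)
  by apply Rlt_le_trans with (1 := Hw), Rmin_r.
assert (Pw : Cmod z / 2 < Cmod w).
{ pose proof (Cmod_triangle w (z - w)) as T.
  replace (w + (z - w))%C with z in T by ring.
  replace (z - w)%C with (- (w - z))%C in T by ring.
  rewrite Cmod_opp in T; fold h in T; lra. }
assert (NW : w <> 0) by (apply Cmod_gt_0; lra).
replace (/ w - / z - (w - z) * - / (z * z))%C
  with ((w - z) * (w - z) / (w * (z * z)))%C by (field; split; assumption).
rewrite Cmod_div, !Cmod_mult by (repeat apply Cmult_neq_0; assumption).
fold h.
apply Rmult_le_reg_r with (Cmod w * (Cmod z * Cmod z)).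
{ repeat apply Rmult_lt_0_compat; lra. }
replace (h * h / (Cmod w * (Cmod z * Cmod z)) * (Cmod w * (Cmod z * Cmod z)))
  with (h * h) by (field; split; lra).
rewrite (Rmult_comm eps h), Rmult_assoc.
apply Rmult_le_compat_l; [apply Cmod_ge_0|].
apply Rlt_le, Rlt_le_trans with (1 := H3).
replace (eps * Cmod z ^ 3 / 2) with (eps * (Cmod z / 2 * (Cmod z * Cmod z)))
  by (simpl; field).
apply Rmult_le_compat_l; [apply Rlt_le, cond_pos|].
apply Rmult_le_compat_r; [apply Rmult_le_pos; lra | lra].
Qed.

(** Action of the matrix with rows [(u, v)] and [(Cconj v, Cconj u)], of determinant
    [Cmod u ^ 2 - Cmod v ^ 2]. The determinant is not normalised, so [mobius 1 (- a)] is the usual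
    map sending [a] to 0; the adjugate matrix, with entries [Cconj u] and [- v], gives the inverse
    in the same family. *)
Definition mobius (u v w : C) : C := ((u * w + v) / (Cconj v * w + Cconj u))%C.

Lemma mobius_denom_neq_0 (u v w : C) :
  Cmod v < Cmod u -> unit_disk w -> (Cconj v * w + Cconj u)%C <> 0.
Proof.
unfold unit_disk; intros Huv Hw E.
assert (E' : Cconj u = (- (Cconj v * w))%C).
{ replace (Cconj u) with (Cconj v * w + Cconj u - Cconj v * w)%C by ring.
  rewrite E; ring. }
apply (f_equal Cmod) in E'.
rewrite Cmod_opp, Cmod_mult, !Cmod_conj in E'.
pose proof (Cmod_ge_0 v).
assert (Cmod v * Cmod w <= Cmod v * 1)
  by (apply Rmult_le_compat_l; lra).
lra.
Qed.

Lemma Cmod_lt_of_sqr (a b : C) : Cmod a ^ 2 < Cmod b ^ 2 -> Cmod a < Cmod b.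
Proof.
intros H; apply Rnot_le_lt; intros L.
pose proof (pow_incr _ _ 2 (conj (Cmod_ge_0 b) L)); lra.
Qed.

Lemma sqr_lt_sqr (a b : R) : 0 <= a -> a < b -> a ^ 2 < b ^ 2.
Proof. intros; nra. Qed.

(** The matrix multiplies the Hermitian form of signature (1,1) by its determinant; the sign of that
    form decides membership in the disk. *)
Lemma mobius_Cmod_identity (u v w : C) :
  Cmod (Cconj v * w + Cconj u) ^ 2 - Cmod (u * w + v) ^ 2
  = (Cmod u ^ 2 - Cmod v ^ 2) * (1 - Cmod w ^ 2).
Proof. rewrite !Cmod2_alt; unfold Re, Im; simpl; ring. Qed.

Lemma mobius_disk (u v w : C) :
  Cmod v < Cmod u -> unit_disk w -> unit_disk (mobius u v w).
Proof.
intros Huv Hw.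
pose proof (mobius_denom_neq_0 u v w Huv Hw) as N.
unfold unit_disk, mobius in *.
rewrite Cmod_div by exact N.
apply Rmult_lt_reg_r with (Cmod (Cconj v * w + Cconj u)).
{ apply Cmod_gt_0, N. }
unfold Rdiv; rewrite Rmult_assoc, Rinv_l, Rmult_1_r, Rmult_1_l by
  (apply Rgt_not_eq, Cmod_gt_0, N).
apply Cmod_lt_of_sqr.
pose proof (mobius_Cmod_identity u v w) as I.
pose proof (sqr_lt_sqr _ _ (Cmod_ge_0 v) Huv).
pose proof (sqr_lt_sqr _ _ (Cmod_ge_0 w) Hw).
assert (0 < (Cmod u ^ 2 - Cmod v ^ 2) * (1 - Cmod w ^ 2))
  by (apply Rmult_lt_0_compat; lra).
lra.
Qed.

Lemma Cmod_sqr_diff_neq_0 (u v : C) :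
  Cmod v < Cmod u -> (u * Cconj u - v * Cconj v)%C <> 0.
Proof.
intros H; rewrite <- !Cmod2_conj, <- RtoC_minus.
intros E; apply RtoC_inj in E.
pose proof (sqr_lt_sqr _ _ (Cmod_ge_0 v) H); lra.
Qed.

Lemma mobius_inverse (u v w : C) :
  Cmod v < Cmod u -> unit_disk w ->
  mobius (Cconj u) (- v) (mobius u v w) = w.
Proof.
intros Huv Hw.
pose proof (mobius_denom_neq_0 u v w Huv Hw) as N.
pose proof (Cmod_sqr_diff_neq_0 u v Huv) as N2.
unfold mobius; rewrite Cconj_conj, Copp_conj.
field; split; [exact N|].
intros E; apply N2; rewrite <- E; ring.
Qed.

Lemma mobius_inverse_l (u v w : C) :
  Cmod v < Cmod u -> unit_disk w ->
  mobius u v (mobius (Cconj u) (- v) w) = w.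
Proof.
intros Huv Hw.
rewrite <- (Cconj_conj u) at 1.
rewrite <- (mobius_inverse (Cconj u) (- v) w) at 2.
- f_equal; ring.
- rewrite Cmod_opp, Cmod_conj; exact Huv.
- exact Hw.
Qed.

Lemma is_cderive_mobius (u v w : C) :
  Cmod v < Cmod u -> unit_disk w ->
  is_cderive (mobius u v) w
    ((u * Cconj u - v * Cconj v)
     / ((Cconj v * w + Cconj u) * (Cconj v * w + Cconj u)))%C.
Proof.
intros Huv Hw.
pose proof (mobius_denom_neq_0 u v w Huv Hw) as N.
assert (L : forall a b : C, is_cderive (fun w => a * w + b)%C w a).
{ intros a b.
  pose proof (is_cderive_plus _ _ w _ _
    (is_cderive_mult _ _ w _ _ (is_cderive_const a w) (is_cderive_id w))
    (is_cderive_const b w)) as H.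
  cbv beta in H.
  replace (0 * w + a * 1 + 0)%C with a in H by ring; exact H. }
pose proof (is_cderive_comp Cinv _ w _ _ (is_cderive_inv _ N) (L _ _)) as I.
pose proof (is_cderive_mult _ _ w _ _ (L u v) I) as M; cbv beta in M.
match type of M with is_cderive _ _ ?p =>
  match goal with |- is_cderive _ _ ?q =>
    replace q with p by (field; exact N) end end.
exact M.
Qed.

Lemma mobius_automorphism (u v : C) :
  Cmod v < Cmod u -> disk_automorphism (mobius u v).
Proof.
intros Huv.
assert (Huv' : Cmod (- v) < Cmod (Cconj u))
  by (rewrite Cmod_opp, Cmod_conj; exact Huv).
split; [|split; [|exists (mobius (Cconj u) (- v)); repeat split]].
- intros w Hw; apply mobius_disk; assumption.
- intros w Hw; eexists; apply is_cderive_mobius; assumption.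
- intros w Hw; apply mobius_disk; assumption.
- intros w Hw; eexists; apply is_cderive_mobius; assumption.
- intros w Hw; apply mobius_inverse; assumption.
- intros w Hw; apply mobius_inverse_l; assumption.
Qed.

(** Composing with [mobius 1 z] before and [mobius 1 (- f z)] after moves both points to 0. By the
    chain rule these two maps contribute the factors [1 - Cmod z ^ 2] and [1 / (1 - Cmod (f z) ^ 2)]
    to the derivative at 0. *)
Lemma schwarz_pick_derivative (f : C -> C) (z d : C) :
  holomorphic_on unit_disk f ->
  (forall w, unit_disk w -> unit_disk (f w)) ->
  unit_disk z -> is_cderive f z d ->
  Cmod d * (1 - Cmod z ^ 2) <= 1 - Cmod (f z) ^ 2.
Proof.
intros Hf B Hz Hd.
set (a := f z).
assert (Ha : unit_disk a) by apply B, Hz.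
assert (Kz : Cmod z < Cmod 1) by (rewrite Cmod_1; exact Hz).
assert (Ka : Cmod (- a) < Cmod 1) by (rewrite Cmod_opp, Cmod_1; exact Ha).
assert (H0 : unit_disk 0) by (unfold unit_disk; rewrite Cmod_0; lra).
assert (Cj : Cconj 1 = 1) by (unfold Cconj, RtoC; simpl; f_equal; ring).
assert (M0 : mobius 1 z 0 = z).
{ unfold mobius; rewrite Cj; field. }
pose proof (is_cderive_mobius 1 z 0 Kz H0) as D1.
pose proof (is_cderive_mobius 1 (- a) a Ka Ha) as D2.
assert (Hd' : is_cderive f (mobius 1 z 0) d) by (rewrite M0; exact Hd).
pose proof (is_cderive_comp f (mobius 1 z) 0 _ _ Hd' D1) as D3.
assert (D2' : is_cderive (mobius 1 (- a)) (f (mobius 1 z 0)) _)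
  by (rewrite M0; exact D2).
pose proof (is_cderive_comp _ (fun w => f (mobius 1 z w)) 0 _ _ D2' D3) as D4.
apply schwarz_derivative in D4.
- pose proof (Cmod_sqr_diff_neq_0 1 (- a) Ka) as N.
  rewrite Cj, Copp_conj in D4, N.
  match type of D4 with Cmod ?p <= 1 =>
    replace p with (d * (1 - z * Cconj z) / (1 - a * Cconj a))%C in D4 end.
  2: { field; intros E; apply N; rewrite <- E; ring. }
  rewrite <- !Cmod2_conj, <- !RtoC_minus in D4.
  pose proof (sqr_lt_sqr _ _ (Cmod_ge_0 z) Hz).
  pose proof (sqr_lt_sqr _ _ (Cmod_ge_0 a) Ha).
  rewrite Cmod_div, Cmod_mult, !Cmod_R, !Rabs_pos_eq in D4 by
    (try (intros E; apply RtoC_inj in E); lra).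
  apply Rmult_le_compat_r with (r := 1 - Cmod a ^ 2) in D4; [|lra].
  unfold Rdiv in D4; rewrite Rmult_assoc, Rinv_l in D4; lra.
- intros w Hw.
  destruct (holomorphic_cderive _ f (mobius 1 z w) Hf) as [g Hg].
  { apply mobius_disk; assumption. }
  pose proof (is_cderive_comp f (mobius 1 z) w _ _ Hg
    (is_cderive_mobius 1 z w Kz Hw)) as E1.
  eexists.
  refine (is_cderive_comp _ (fun w => f (mobius 1 z w)) w _ _
    (is_cderive_mobius 1 (- a) _ Ka _) E1).
  apply B, mobius_disk; assumption.
- intros w Hw; apply Rlt_le; apply mobius_disk; [exact Ka|].
  apply B, mobius_disk; assumption.
- rewrite M0; fold a; unfold mobius, Cdiv.
  replace (1 * a + - a)%C with (RtoC 0) by ring; ring.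
Qed.

Lemma is_derive_radial (f : C -> C) (z d : C) (s : R) :
  is_cderive f (s * z) d ->
  is_derive (fun t : R => Re (f (t * z)%C)) s (Re (d * z)) /\
  is_derive (fun t : R => Im (f (t * z)%C)) s (Im (d * z)).
Proof.
intros H.
destruct z as [x y].
assert (E : forall t, (RtoC t * (x, y))%C = (t * x, t * y)).
{ intros t; unfold Cmult, RtoC; simpl; f_equal; ring. }
rewrite E in H.
destruct (is_cderive_Re_Im _ _ _ _ H) as [HR HI].
assert (L : forall c, derivable_pt_lim (fun t => t * c) s c).
{ intros c; apply is_derive_Reals; auto_derive; [exact I | ring]. }
split.
- apply is_derive_ext with (fun t => Re (f (t * x, t * y))).
  { intros t; rewrite E; reflexivity. }
  replace (Re (d * (x, y))) with (Re d * x + - Im d * y)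
    by (unfold Re, Im; simpl; ring).
  apply is_derive_Reals.
  apply (derivable_pt_lim_comp_2d (fun a b => Re (f (a, b))));
    [exact HR | apply L | apply L].
- apply is_derive_ext with (fun t => Im (f (t * x, t * y))).
  { intros t; rewrite E; reflexivity. }
  replace (Im (d * (x, y))) with (Im d * x + Re d * y)
    by (unfold Re, Im; simpl; ring).
  apply is_derive_Reals.
  apply (derivable_pt_lim_comp_2d (fun a b => Im (f (a, b))));
    [exact HI | apply L | apply L].
Qed.

Lemma unit_disk_radial (s : R) (z : C) :
  0 <= s <= 1 -> unit_disk z -> unit_disk (s * z).
Proof.
unfold unit_disk; intros Hs Hz.
rewrite Cmod_mult, Cmod_R, Rabs_pos_eq by lra.
pose proof (Cmod_ge_0 z); nra.
Qed.

(* A solution of the differential inequality satisfied by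
   [tanh (artanh (s r))] stays below it. *)
Lemma artanh_comparison (u du : R -> R) (r : R) :
  0 <= r < 1 -> u 0 = 0 ->
  (forall s, 0 <= s <= 1 -> is_derive u s (du s) /\ Rabs (u s) < 1 /\
     du s * (1 - (s * r) ^ 2) <= r * (1 - u s ^ 2)) ->
  u 1 <= r.
Proof.
intros Hr u0 H.
(* [F s] is the exponential of [2 * (artanh (u s) - artanh (s * r))]. The numerator of [dF] is the
   assumed inequality up to the factor 2, so [F] does not exceed [F 0 = 1], and [F 1 <= 1] unfolds
   to [u 1 <= r]. *)
set (F := fun s => (1 + u s) * (1 - s * r) / ((1 - u s) * (1 + s * r))).
set (dF := fun s => 2 * (du s * (1 - (s * r) ^ 2) - r * (1 - u s ^ 2))
                    / ((1 - u s) * (1 + s * r)) ^ 2).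
assert (Dpos : forall s, 0 <= s <= 1 -> 0 < 1 - u s /\ 0 < 1 + s * r).
{ intros s Hs; destruct (H s Hs) as (_ & A & _).
  apply Rabs_def2 in A; split; [lra | nra]. }
assert (HF : forall s, 0 <= s <= 1 -> is_derive F s (dF s)).
{ intros s Hs; destruct (H s Hs) as (D & _ & _).
  destruct (Dpos s Hs).
  unfold F, dF; auto_derive.
  - repeat split; try (exists (du s); exact D).
    apply Rgt_not_eq, Rmult_lt_0_compat; assumption.
  - rewrite (is_derive_unique (fun x => u x) s _ D : Derive (fun x => u x) s = du s); field; lra. }
destruct (MVT_gen F 0 1 dF) as (c & Hc & E).
{ intros s; rewrite Rmin_left, Rmax_right by lra; intros; apply HF; lra. }
{ intros s; rewrite Rmin_left, Rmax_right by lra; intros Hs.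
  apply continuity_pt_filterlim.
  apply (ex_derive_continuous (K := R_AbsRing) (V := R_NormedModule)).
  exists (dF s); apply HF; lra. }
rewrite Rmin_left, Rmax_right in Hc by lra.
assert (N : dF c <= 0).
{ destruct (H c Hc) as (_ & _ & I); destruct (Dpos c Hc) as [P1 P2].
  assert (Q : 0 < / ((1 - u c) * (1 + c * r)) ^ 2).
  { apply Rinv_0_lt_compat, pow_lt, Rmult_lt_0_compat; assumption. }
  unfold dF, Rdiv; nra. }
assert (F1 : F 1 <= 1).
{ assert (F 0 = 1) by (unfold F; rewrite u0; field; lra); lra. }
destruct (Dpos 1) as [P1 P2]; [lra|].
assert (P : 0 < (1 - u 1) * (1 + 1 * r)) by (apply Rmult_lt_0_compat; lra).
apply Rmult_le_compat_r with (r := (1 - u 1) * (1 + 1 * r)) in F1; [|lra].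
unfold F, Rdiv in F1; rewrite Rmult_assoc, Rinv_l in F1; nra.
Qed.

(** The phase [l] is fixed by the end point, so that [Re (l * f (s * z))] equals [Cmod (f z)] at
    [s = 1] and stays differentiable where [f] vanishes. Being at most [Cmod (f (s * z))] in
    absolute value, it inherits the differential inequality from Schwarz-Pick. *)
Lemma schwarz (f : C -> C) (z : C) :
  holomorphic_on unit_disk f ->
  (forall w, unit_disk w -> unit_disk (f w)) ->
  f 0 = 0 -> unit_disk z -> Cmod (f z) <= Cmod z.
Proof.
intros Hf B f0 Hz.
destruct (Ceq_dec (f z) 0) as [E|NZ].
{ rewrite E, Cmod_0; apply Cmod_ge_0. }
destruct (Cmod_phase (f z) NZ) as (l & Hl & Hld).
pose proof (Cmod_ge_0 z) as Z0.
(* A derivative is chosen at every real [s], with the dummy value 0 outside [[0, 1]]. *)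
destruct (functional_choice (fun (s d : R) => 0 <= s <= 1 ->
    is_derive (fun t : R => Re (l * f (t * z))%C) s d /\
    d * (1 - (s * Cmod z) ^ 2) <= Cmod z * (1 - Cmod (f (s * z)%C) ^ 2)))
  as [du Hdu].
{ intros s.
  destruct (Rle_dec 0 s); [|exists 0; intros; lra].
  destruct (Rle_dec s 1); [|exists 0; intros; lra].
  assert (Hs : unit_disk (s * z)) by (apply unit_disk_radial; [lra|exact Hz]).
  destruct (holomorphic_cderive _ f _ Hf Hs) as [g Hg].
  exists (Re (l * g * z)); intros _; split.
  - apply (is_derive_radial (fun w => l * f w)%C).
    replace (l * g)%C with (0 * f (s * z) + l * g)%C by ring.
    apply (is_cderive_mult (fun _ => l)); [apply is_cderive_const | exact Hg].
  - pose proof (schwarz_pick_derivative f _ _ Hf B Hs Hg) as SP.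
    rewrite Cmod_mult, Cmod_R, Rabs_pos_eq in SP by lra.
    assert (Re (l * g * z) <= Cmod g * Cmod z).
    { apply Rle_trans with (1 := Rle_abs _).
      eapply Rle_trans; [apply re_le_Cmod|].
      rewrite !Cmod_mult, Hl; lra. }
    assert (0 < 1 - (s * Cmod z) ^ 2).
    { unfold unit_disk in *.
      rewrite Cmod_mult, Cmod_R, Rabs_pos_eq in Hs by lra.
      assert (0 <= s * Cmod z) by (apply Rmult_le_pos; lra).
      nra. }
    apply Rle_trans with (Cmod g * Cmod z * (1 - (s * Cmod z) ^ 2)).
    + apply Rmult_le_compat_r; lra.
    + replace (Cmod g * Cmod z * (1 - (s * Cmod z) ^ 2))
        with (Cmod z * (Cmod g * (1 - (s * Cmod z) ^ 2))) by ring.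
      apply Rmult_le_compat_l; lra. }
assert (K : Re (l * f (1%R * z))%C <= Cmod z).
{ apply (artanh_comparison (fun t : R => Re (l * f (t * z))%C) du).
  - split; [apply Z0 | exact Hz].
  - replace (0%R * z)%C with (RtoC 0) by ring.
    rewrite f0; unfold Re; simpl; ring.
  - intros s Hs; destruct (Hdu s Hs) as [D1 D2].
    assert (B' : Rabs (Re (l * f (s * z))%C) <= Cmod (f (s * z)%C)).
    { eapply Rle_trans; [apply re_le_Cmod|].
      rewrite Cmod_mult, Hl; lra. }
    split; [exact D1|]; split.
    + apply Rle_lt_trans with (1 := B'), B.
      apply unit_disk_radial; assumption.
    + apply Rle_trans with (1 := D2), Rmult_le_compat_l; [exact Z0|].
      rewrite <- (pow2_abs (Re _)).
      pose proof (pow_incr _ _ 2 (conj (Rabs_pos _) B')); lra. }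
replace (1%R * z)%C with z in K by ring.
rewrite Hld in K; exact K.
Qed.

(** The Schwarz lemma is applied twice: to [f] followed by the Moebius map sending [f 0] to 0, and
    to the inverse of this composite, built from [g]. *)
Lemma automorphism_isometry (f : C -> C) (z : C) :
  disk_automorphism f -> unit_disk z ->
  Cmod (mobius 1 (- f 0) (f z)) = Cmod z.
Proof.
intros (B & Hf & g & Bg & Hg & gf & fg) Hz.
set (a := f 0).
assert (H0 : unit_disk 0) by (unfold unit_disk; rewrite Cmod_0; lra).
assert (Ha : unit_disk a) by apply B, H0.
assert (Ka : Cmod (- a) < Cmod 1) by (rewrite Cmod_opp, Cmod_1; exact Ha).
assert (Ka' : Cmod a < Cmod 1) by (rewrite Cmod_1; exact Ha).
assert (Cj : Cconj 1 = 1) by (unfold Cconj, RtoC; simpl; f_equal; ring).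
apply Rle_antisym.
- apply (schwarz (fun w => mobius 1 (- a) (f w))).
  + intros w Hw; destruct (holomorphic_cderive _ f w Hf Hw) as [d Hd].
    eexists.
    apply (is_cderive_comp (mobius 1 (- a)) f); [|exact Hd].
    apply is_cderive_mobius; [exact Ka | apply B, Hw].
  + intros w Hw; apply mobius_disk; [exact Ka | apply B, Hw].
  + fold a; unfold mobius, Cdiv.
    replace (1 * a + - a)%C with (RtoC 0) by ring; ring.
  + exact Hz.
- assert (Hw : unit_disk (mobius 1 (- a) (f z)))
    by (apply mobius_disk; [exact Ka | apply B, Hz]).
  assert (E : g (mobius 1 a (mobius 1 (- a) (f z))) = z).
  { pose proof (mobius_inverse 1 (- a) (f z) Ka (B z Hz)) as I.
    rewrite Cj in I; replace (- - a)%C with a in I by ring.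
    rewrite I; apply gf, Hz. }
  rewrite <- E at 1.
  apply (schwarz (fun w => g (mobius 1 a w))).
  + intros w Hw'.
    destruct (holomorphic_cderive _ g (mobius 1 a w) Hg) as [d Hd].
    { apply mobius_disk; assumption. }
    eexists; apply (is_cderive_comp g (mobius 1 a)); [exact Hd|].
    apply is_cderive_mobius; assumption.
  + intros w Hw'; apply Bg, mobius_disk; assumption.
  + replace (mobius 1 a 0) with a; [apply gf, H0|].
    unfold mobius; rewrite Cj; field.
  + exact Hw.
Qed.

(** * Derivatives on the half-line *)

Lemma is_derive_R_iff (g : R -> R) (t l : R) :
  is_derive g t l <->
  forall eps : posreal, exists delta : posreal, forall s,
    Rabs (s - t) < delta ->
    Rabs (g s - g t - (s - t) * l) <= eps * Rabs (s - t).
Proof.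
split.
- intros [_ H] eps.
  destruct (H t (fun P HP => HP) eps) as [delta Hd].
  exists delta; intros s Hs; exact (Hd s Hs).
- intros H; split.
  + exact (is_linear_scal_l (K := R_AbsRing) (V := R_NormedModule) l).
  + intros x Hx eps.
    assert (E : t = x) by exact (is_filter_lim_locally_unique
      (K := R_AbsRing) (V := R_NormedModule) t x Hx).
    subst x.
    destruct (H eps) as [delta Hd].
    exists delta; intros s Hs; exact (Hd s Hs).
Qed.

Lemma derive_half_line_zero (g : R -> R) (l : R) :
  is_derive g 0 l -> (forall t, 0 <= t -> g t = 0) -> l = 0.
Proof.
intros H Z; rewrite is_derive_R_iff in H.
destruct (Req_dec l 0) as [|NZ]; [assumption|exfalso].
assert (P : 0 < Rabs l / 2) by (pose proof (Rabs_pos_lt l NZ); lra).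
destruct (H (mkposreal _ P)) as [delta Hd]; simpl in Hd.
pose proof (cond_pos delta) as Pd.
specialize (Hd (delta / 2)).
rewrite !Z, (Rminus_0_r (delta / 2)), (Rabs_pos_eq (delta / 2)) in Hd by lra.
specialize (Hd ltac:(lra)).
replace (0 - 0 - delta / 2 * l) with (- (delta / 2 * l)) in Hd by ring.
rewrite Rabs_Ropp, Rabs_mult, (Rabs_pos_eq (delta / 2)) in Hd by lra.
nra.
Qed.

(** Continuing [g] to the left of 0 by its tangent line turns the one-sided derivative at 0 into a
    two-sided one, so that the ordinary calculus applies. *)
Lemma is_derive_linear_extension (g dg : R -> R) :
  (forall t, 0 <= t -> forall eps : posreal, exists delta : posreal,
     forall s, 0 <= s -> Rabs (s - t) < delta ->
       Rabs (g s - g t - (s - t) * dg t) <= eps * Rabs (s - t)) ->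
  forall t, 0 <= t ->
    is_derive (fun s => if Rle_dec 0 s then g s else g 0 + s * dg 0) t (dg t).
Proof.
intros H t Ht; apply is_derive_R_iff; intros eps.
destruct (H t Ht eps) as [delta Hd].
destruct (Rle_dec 0 t); [|lra].
destruct (Req_dec t 0) as [E|NE].
- subst t; exists delta; intros s Hs.
  destruct (Rle_dec 0 s); [apply Hd; assumption|].
  replace (g 0 + s * dg 0 - g 0 - (s - 0) * dg 0) with 0 by ring.
  rewrite Rabs_R0; apply Rmult_le_pos; [apply Rlt_le, cond_pos|].
  apply Rabs_pos.
- assert (P : 0 < Rmin delta t) by (apply Rmin_pos; [apply cond_pos | lra]).
  exists (mkposreal _ P); simpl; intros s Hs.
  assert (H1 : Rabs (s - t) < delta)
    by apply Rlt_le_trans with (1 := Hs), Rmin_l.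
  assert (H2 : Rabs (s - t) < t) by apply Rlt_le_trans with (1 := Hs), Rmin_r.
  apply Rabs_def2 in H2.
  destruct (Rle_dec 0 s); [|lra].
  apply Hd; assumption.
Qed.

Lemma is_derive_nonneg_eps (u : R -> C) (t : R) (v : C) :
  is_derive_nonneg u t v ->
  forall eps : posreal, exists delta : posreal, forall s,
    0 <= s -> Rabs (s - t) < delta ->
    Cmod (u s - u t - (s - t)%R * v) <= eps * Rabs (s - t).
Proof.
intros [_ H] eps.
destruct (H t (fun P HP => filter_le_within _ P HP) eps) as [delta Hd].
exists delta; intros s Hs Hst.
specialize (Hd s Hst Hs).
replace (u s - u t - (s - t)%R * v)%C
  with (minus (minus (u s : C_R_NormedModule) (u t))
          (scal (minus s t) (v : C_R_NormedModule))).
- rewrite Cmod_norm; exact Hd.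
- apply injective_projections.
  + change (fst (u s) + - fst (u t) + - ((s + - t) * fst v)
      = fst (u s) + - fst (u t) + - ((s - t) * fst v - 0 * snd v)); ring.
  + change (snd (u s) + - snd (u t) + - ((s + - t) * snd v)
      = snd (u s) + - snd (u t) + - ((s - t) * snd v + 0 * fst v)); ring.
Qed.

Lemma is_derive_nonneg_coordinates (u v : R -> C) :
  (forall t, 0 <= t -> is_derive_nonneg u t (v t)) ->
  exists a b : R -> R,
    (forall t, 0 <= t -> u t = (a t, b t)) /\
    (forall t, 0 <= t -> is_derive a t (Re (v t)) /\ is_derive b t (Im (v t))).
Proof.
intros H.
exists (fun s => if Rle_dec 0 s then Re (u s) else Re (u 0) + s * Re (v 0)).
exists (fun s => if Rle_dec 0 s then Im (u s) else Im (u 0) + s * Im (v 0)).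
split.
- intros t Ht; destruct (Rle_dec 0 t); [|lra].
  apply surjective_pairing.
- intros t Ht; split.
  + apply (is_derive_linear_extension (fun s => Re (u s)) (fun s => Re (v s)));
      [|exact Ht].
    intros r Hr eps.
    destruct (is_derive_nonneg_eps u r (v r) (H r Hr) eps) as [delta Hd].
    exists delta; intros s Hs Hsr.
    apply Rle_trans with (2 := Hd s Hs Hsr).
    eapply Rle_trans; [|apply Rmax_Cmod].
    eapply Rle_trans; [|apply Rmax_l].
    right; f_equal; unfold Re; simpl; ring.
  + apply (is_derive_linear_extension (fun s => Im (u s)) (fun s => Im (v s)));
      [|exact Ht].
    intros r Hr eps.
    destruct (is_derive_nonneg_eps u r (v r) (H r Hr) eps) as [delta Hd].
    exists delta; intros s Hs Hsr.
    apply Rle_trans with (2 := Hd s Hs Hsr).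
    eapply Rle_trans; [|apply Rmax_Cmod].
    eapply Rle_trans; [|apply Rmax_r].
    right; f_equal; unfold Im; simpl; ring.
Qed.

(* Differentiating at [t = 0] the conservation of the pseudo-hyperbolic
   distance between the orbits of [0] and [z]. *)
Lemma automorphic_generator_tangent (G : C -> C) (psi : R -> C -> C) (z : C) :
  (forall w, unit_disk w -> psi 0 w = w /\ forall t, 0 <= t ->
     unit_disk (psi t w) /\
     is_derive_nonneg (fun s => psi s w) t (G (psi t w))) ->
  family_of_automorphisms psi -> unit_disk z ->
  Re (Cconj z * (G z - G 0 + Cconj (G 0) * (z * z))) = 0.
Proof.
intros Hpsi Haut Hz.
assert (H0 : unit_disk 0) by (unfold unit_disk; rewrite Cmod_0; lra).
destruct (Hpsi z Hz) as [Ez Dz]; destruct (Hpsi 0 H0) as [E0 D0].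
destruct (is_derive_nonneg_coordinates (fun s => psi s 0)
  (fun t => G (psi t 0))) as (a1 & b1 & Eq1 & Der1); [apply D0|].
destruct (is_derive_nonneg_coordinates (fun s => psi s z)
  (fun t => G (psi t z))) as (a2 & b2 & Eq2 & Der2); [apply Dz|].
destruct z as [x y].
(* With [w1] and [w2] the orbits of 0 and [z], this is [|w2 - w1|^2 - |z|^2 |1 - conj w1 w2|^2]: the
   conservation law squared and cleared of its denominator, a polynomial in the coordinates. *)
set (phi := fun t => (a2 t - a1 t) ^ 2 + (b2 t - b1 t) ^ 2
  - (x ^ 2 + y ^ 2) * ((1 - a1 t * a2 t - b1 t * b2 t) ^ 2
                       + (a1 t * b2 t - b1 t * a2 t) ^ 2)).
destruct (Der1 0 (Rle_refl 0)) as [Da1 Db1].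
destruct (Der2 0 (Rle_refl 0)) as [Da2 Db2].
rewrite E0 in Da1, Db1; rewrite Ez in Da2, Db2.
pose proof (Eq1 0 (Rle_refl 0)) as I1; pose proof (Eq2 0 (Rle_refl 0)) as I2.
simpl in I1, I2; rewrite E0 in I1; rewrite Ez in I2.
injection I1; injection I2; intros Ib2 Ia2 Ib1 Ia1.
assert (Dphi : is_derive phi 0
  (2 * Re (Cconj (x, y) * (G (x, y) - G 0 + Cconj (G 0) * ((x, y) * (x, y)))))).
{ unfold phi; auto_derive.
  - repeat split; eexists; eassumption.
  - rewrite (is_derive_unique (fun x => a1 x) 0 _ Da1
      : Derive (fun x => a1 x) 0 = _).
    rewrite (is_derive_unique (fun x => b1 x) 0 _ Db1
      : Derive (fun x => b1 x) 0 = _).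
    rewrite (is_derive_unique (fun x => a2 x) 0 _ Da2
      : Derive (fun x => a2 x) 0 = _).
    rewrite (is_derive_unique (fun x => b2 x) 0 _ Db2
      : Derive (fun x => b2 x) 0 = _).
    rewrite <- Ia1, <- Ib1, <- Ia2, <- Ib2.
    unfold Re, Im; simpl; ring. }
assert (phi0 : forall t, 0 <= t -> phi t = 0).
{ intros t Ht.
  pose proof (automorphism_isometry (psi t) (x, y) (Haut t Ht) Hz) as I.
  destruct (D0 t Ht) as [P1 _]; destruct (Dz t Ht) as [P2 _].
  assert (N : (Cconj (- psi t 0) * psi t (x, y) + Cconj 1)%C <> 0).
  { apply mobius_denom_neq_0; [|exact P2].
    rewrite Cmod_opp, Cmod_1; exact P1. }
  unfold mobius in I; rewrite Cmod_div in I by exact N.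
  assert (PN : Cmod (Cconj (- psi t 0) * psi t (x, y) + Cconj 1) <> 0)
    by (apply Rgt_not_eq, Cmod_gt_0, N).
  assert (I' : Cmod (1 * psi t (x, y) + - psi t 0) ^ 2 = Cmod (x, y) ^ 2 *
     Cmod (Cconj (- psi t 0) * psi t (x, y) + Cconj 1) ^ 2).
  { rewrite <- I; field; exact PN. }
  rewrite Eq1, Eq2, !Cmod2_alt in I' by exact Ht.
  unfold phi; unfold Re, Im in I'; simpl in I' |- *.
  lra. }
pose proof (derive_half_line_zero _ _ Dphi phi0); lra.
Qed.

(** * Generators of automorphisms and their flows *)

Lemma unit_disk_open (w z : C) :
  unit_disk w -> Cmod (z - w) < 1 - Cmod w -> unit_disk z.
Proof.
unfold unit_disk; intros Hw Hz.
pose proof (Cmod_triangle w (z - w)) as T.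
replace (w + (z - w))%C with z in T by ring; lra.
Qed.

Lemma is_derive_line (f : C -> C) (w h d : C) :
  is_cderive f w d ->
  is_derive (fun t : R => Re (f (w + t * h)%C)) 0 (Re (d * h)) /\
  is_derive (fun t : R => Im (f (w + t * h)%C)) 0 (Im (d * h)).
Proof.
intros H.
apply (is_derive_radial (fun q => f (w + q)%C)).
assert (T : is_cderive (fun q => w + q)%C (0%R * h) (0 + 1))
  by (apply is_cderive_plus; [apply is_cderive_const | apply is_cderive_id]).
replace d with ((0 + 1) * d)%C by ring.
apply (is_cderive_comp f (fun q => w + q)%C); [|exact T].
replace (w + 0%R * h)%C with w by ring; exact H.
Qed.

Lemma tangent_derivative (H : C -> C) (w h d : C) :
  (forall z, unit_disk z -> Re (Cconj z * H z) = 0) ->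
  unit_disk w -> is_cderive H w d ->
  Re (Cconj h * H w) + Re (Cconj w * (d * h)) = 0.
Proof.
intros T Hw Hd.
destruct (is_derive_line H w h d Hd) as [DR DI].
set (g := fun t : R => Re (Cconj (w + t * h) * H (w + t * h)%C)).
set (A := fun t : R => Re (H (w + t * h)%C)) in DR.
set (B := fun t : R => Im (H (w + t * h)%C)) in DI.
assert (E : forall t,
  (Re w + t * Re h) * A t + (Im w + t * Im h) * B t = g t).
{ intros t; unfold A, B, g, Re, Im; simpl; ring. }
assert (Dg : is_derive g 0
          (Re (Cconj h * H w) + Re (Cconj w * (d * h)))).
{ apply (is_derive_ext _ g _ _ E).
  auto_derive; [repeat split; eexists; eassumption|].
  rewrite (is_derive_unique _ _ _ DR : Derive (fun x => A x) 0 = _).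
  rewrite (is_derive_unique _ _ _ DI : Derive (fun x => B x) 0 = _).
  unfold A, B; replace (w + 0%R * h)%C with w by ring.
  unfold Re, Im; simpl; ring. }
(* For [t] below this bound [w + t h] remains in the disk; the 1 in the divisor covers [h = 0]. *)
assert (P : 0 < (1 - Cmod w) / (1 + Cmod h)).
{ unfold unit_disk in Hw; pose proof (Cmod_ge_0 h).
  apply Rdiv_lt_0_compat; lra. }
assert (Z : is_derive g 0 0).
{ apply is_derive_ext_loc with (fun _ => 0);
    [|apply (is_derive_const (K := R_AbsRing) (V := R_NormedModule))].
  exists (mkposreal _ P); intros t Ht.
  assert (Ht' : Rabs t < (1 - Cmod w) / (1 + Cmod h)).
  { replace t with (t - 0) by ring; exact Ht. }
  symmetry; apply T, (unit_disk_open w); [exact Hw|].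
  replace (w + t * h - w)%C with (t * h)%C by ring.
  rewrite Cmod_mult, Cmod_R.
  pose proof (Cmod_ge_0 h); pose proof (Rabs_pos t).
  apply Rmult_lt_compat_r with (r := 1 + Cmod h) in Ht'; [|lra].
  unfold Rdiv in Ht'; rewrite Rmult_assoc, Rinv_l in Ht'; lra. }
transitivity (Derive g 0); [symmetry|]; apply is_derive_unique; assumption.
Qed.

(** The directions [1] and [i] in [tangent_derivative] together give [H w = - w * Cconj d]. Tangency
    at [w] then makes [d] purely imaginary, so [- Cconj d = d]. The result is Euler's relation for
    functions homogeneous of degree 1. *)
Lemma tangent_euler (H : C -> C) (w d : C) :
  (forall z, unit_disk z -> Re (Cconj z * H z) = 0) ->
  unit_disk w -> w <> 0 -> is_cderive H w d -> H w = (d * w)%C.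
Proof.
intros T Hw NZ Hd.
pose proof (tangent_derivative H w 1 d T Hw Hd) as T1.
pose proof (tangent_derivative H w Ci d T Hw Hd) as Ti.
pose proof (T w Hw) as T0.
destruct w as [x y], d as [c e].
destruct (H (x, y)) as [A B].
unfold Re in *; simpl in *.
assert (N : x ^ 2 + y ^ 2 <> 0).
{ intros E; apply NZ; apply injective_projections; simpl; nra. }
assert (Ec : c * (x ^ 2 + y ^ 2) = 0) by nra.
apply Rmult_integral in Ec; destruct Ec as [Ec|]; [|contradiction].
subst c; apply injective_projections; simpl; lra.
Qed.

Lemma euler_linear (g : R -> R) (s : R) :
  0 < s < 1 ->
  (forall t, s <= t <= 1 -> exists d, is_derive g t d /\ g t = d * t) ->
  g s = s * g 1.
Proof.
intros Hs H.
assert (E : g s / s = g 1 / 1).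
{ apply (eq_is_derive (fun t => g t / t) s 1); [|lra].
  intros t Ht; destruct (H t Ht) as (d & D & E).
  change (is_derive (fun t => g t / t) t 0).
  auto_derive; [repeat split; [eexists; exact D | lra]|].
  rewrite (is_derive_unique _ _ _ D : Derive (fun x => g x) t = _), E.
  field; lra. }
replace (g 1) with (g 1 / 1) by field; rewrite <- E; field; lra.
Qed.

(** Euler's relation makes [H] homogeneous of degree 1 along radii, differentiability at 0 then
    forces [H z = d0 * z], and tangency at the sample point [1 / 2] makes [d0] imaginary. *)
Lemma tangent_is_rotation (H : C -> C) :
  holomorphic_on unit_disk H -> H 0 = 0 ->
  (forall z, unit_disk z -> Re (Cconj z * H z) = 0) ->
  exists b : R, forall z, unit_disk z -> H z = (Ci * b * z)%C.
Proof.
intros Hh H0 T.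
assert (D0 : unit_disk 0) by (unfold unit_disk; rewrite Cmod_0; lra).
destruct (holomorphic_cderive _ H 0 Hh D0) as [d0 Hd0].
assert (L : forall z, unit_disk z -> H z = (d0 * z)%C).
{ intros z Hz.
  destruct (Ceq_dec z 0) as [E|NZ]; [rewrite E, H0; ring|].
  assert (K : forall s, 0 < s < 1 -> H (s * z)%C = (s * H z)%C).
  { intros s Hs.
    assert (Dz : forall t, s <= t <= 1 -> exists d,
      is_cderive H (t * z) d /\ H (t * z)%C = (d * (t * z))%C).
    { intros t Ht.
      assert (Hw : unit_disk (t * z)) by (apply unit_disk_radial; [lra|exact Hz]).
      destruct (holomorphic_cderive _ H _ Hh Hw) as [d Hd].
      exists d; split; [exact Hd|]; apply tangent_euler; try assumption.
      apply Cmult_neq_0; [|exact NZ].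
      intros E; apply RtoC_inj in E; lra. }
    apply injective_projections.
    - transitivity (s * Re (H (1%R * z)%C)).
      + apply (euler_linear (fun t => Re (H (t * z)%C)) s Hs).
        intros t Ht; destruct (Dz t Ht) as (d & Hd & E).
        exists (Re (d * z)); split; [apply is_derive_radial, Hd|].
        rewrite E; unfold Re; simpl; ring.
      + replace (1%R * z)%C with z by ring; unfold Re; simpl; ring.
    - transitivity (s * Im (H (1%R * z)%C)).
      + apply (euler_linear (fun t => Im (H (t * z)%C)) s Hs).
        intros t Ht; destruct (Dz t Ht) as (d & Hd & E).
        exists (Im (d * z)); split; [apply is_derive_radial, Hd|].
        rewrite E; unfold Im; simpl; ring.
      + replace (1%R * z)%C with z by ring; unfold Im; simpl; ring. }
  destruct (Ceq_dec (H z - d0 * z) 0) as [E|N].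
  { replace (H z) with (H z - d0 * z + d0 * z)%C by ring; rewrite E; ring. }
  exfalso.
  assert (P : 0 < Cmod (H z - d0 * z)) by (apply Cmod_gt_0, N).
  assert (Pz : 0 < Cmod z) by (apply Cmod_gt_0, NZ).
  rewrite is_cderive_iff in Hd0.
  (* By homogeneity the first-order remainder at [s z] has modulus exactly [s m], with
     [m = Cmod (H z - d0 * z)]. With [eps = m / 2] it would be at most [s |z| m / 2], which is
     smaller. *)
  destruct (Hd0 (mkposreal _ (Rdiv_lt_0_compat _ 2 P Rlt_0_2)))
    as [delta Hd]; simpl in Hd.
  set (s := Rmin (delta / 2) (1 / 2)).
  assert (S0 : 0 < s)
    by (apply Rmin_pos; [pose proof (cond_pos delta)|]; lra).
  assert (S1 : s <= delta / 2) by apply Rmin_l.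
  assert (S2 : s <= 1 / 2) by apply Rmin_r.
  unfold unit_disk in Hz.
  assert (B : Cmod (s * z) < delta).
  { rewrite Cmod_mult, Cmod_R, Rabs_pos_eq by lra.
    pose proof (cond_pos delta); nra. }
  specialize (Hd (s * z)%C).
  replace (s * z - 0)%C with (s * z)%C in Hd by ring.
  specialize (Hd B).
  rewrite K, H0 in Hd by lra.
  replace (s * H z - 0 - s * z * d0)%C with (s * (H z - d0 * z))%C in Hd
    by ring.
  rewrite !Cmod_mult, !Cmod_R, !Rabs_pos_eq in Hd by lra.
  set (m := Cmod (H z - d0 * z)) in *.
  assert (s * m <= s * (m / 2)).
  { apply Rle_trans with (1 := Hd).
    replace (m / 2 * (s * Cmod z)) with (s * (m / 2) * Cmod z) by ring.
    rewrite <- (Rmult_1_r (s * (m / 2))) at 2.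
    apply Rmult_le_compat_l; [apply Rmult_le_pos|]; lra. }
  apply Rmult_le_reg_l in H1; lra. }
exists (Im d0); intros z Hz; rewrite (L z Hz).
assert (Hh2 : unit_disk (/ 2)%R).
{ unfold unit_disk; rewrite Cmod_R, Rabs_pos_eq; lra. }
pose proof (T _ Hh2) as Q; rewrite (L _ Hh2) in Q.
destruct d0 as [c e].
assert (Ec : c = 0) by (unfold Re in Q; simpl in Q; lra).
subst c; apply injective_projections; simpl; ring.
Qed.

Lemma automorphic_generator_form (G : C -> C) (psi : R -> C -> C) :
  holomorphic_on unit_disk G ->
  (forall w, unit_disk w -> psi 0 w = w /\ forall t, 0 <= t ->
     unit_disk (psi t w) /\
     is_derive_nonneg (fun s => psi s w) t (G (psi t w))) ->
  family_of_automorphisms psi ->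
  exists (a : C) (b : R), forall w, unit_disk w ->
    G w = (a - Cconj a * (w * w) + Ci * b * w)%C.
Proof.
intros HG Hpsi Haut.
set (a := G 0).
destruct (tangent_is_rotation
  (fun w => G w + (- a + Cconj a * (w * w)))%C) as [b Hb].
- intros w Hw; destruct (holomorphic_cderive _ G w HG Hw) as [d Hd].
  eexists; apply (is_cderive_plus G); [exact Hd|].
  apply (is_cderive_plus (fun _ => - a)%C); [apply is_cderive_const|].
  apply (is_cderive_mult (fun _ => Cconj a)); [apply is_cderive_const|].
  apply is_cderive_mult; apply is_cderive_id.
- unfold a; ring.
- intros z Hz.
  pose proof (automorphic_generator_tangent G psi z Hpsi Haut Hz) as T.
  fold a in T; rewrite <- T; f_equal; ring.
- exists a, b; intros w Hw; rewrite <- (Hb w Hw); ring.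
Qed.

(* Coefficients of [exp (t A) = c t + s t A] for a matrix [A] with
   [A^2 = lambda]. *)
Lemma exp_coefficients (lambda : R) :
  exists c s : R -> R, c 0 = 1 /\ s 0 = 0 /\
    (forall t, is_derive c t (lambda * s t)) /\
    (forall t, is_derive s t (c t)) /\
    (forall t, c t ^ 2 - lambda * s t ^ 2 = 1).
Proof.
(* Elliptic, parabolic and hyperbolic flows. The last identity says that [exp (t A)] has determinant
   1 when [A] has trace 0. *)
destruct (Rtotal_order lambda 0) as [N|[Z|P]].
- set (r := sqrt (- lambda)).
  assert (Hr : 0 < r) by (apply sqrt_lt_R0; lra).
  assert (E : lambda = - (r * r)) by (unfold r; rewrite sqrt_sqrt; lra).
  exists (fun t => cos (r * t)), (fun t => sin (r * t) / r).
  rewrite Rmult_0_r, cos_0, sin_0, E.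
  split; [reflexivity|]; split; [field; lra|]; split; [|split]; intros t.
  + auto_derive; [exact I | field; lra].
  + auto_derive; [exact I | field; lra].
  + pose proof (sin2_cos2 (r * t)) as T; unfold Rsqr in T.
    rewrite <- T; field; lra.
- exists (fun _ => 1), (fun t => t); subst lambda.
  split; [reflexivity|]; split; [reflexivity|]; split; [|split]; intros t;
    [auto_derive; [exact I | ring] | auto_derive; [exact I | ring] | ring].
- set (r := sqrt lambda).
  assert (Hr : 0 < r) by (apply sqrt_lt_R0; lra).
  assert (E : lambda = r * r) by (unfold r; rewrite sqrt_sqrt; lra).
  exists (fun t => (exp (r * t) + exp (- (r * t))) / 2),
    (fun t => (exp (r * t) - exp (- (r * t))) / (2 * r)).
  rewrite Rmult_0_r, Ropp_0, exp_0, E.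
  split; [field|]; split; [field; lra|]; split; [|split]; intros t.
  + auto_derive; [exact I | field; lra].
  + auto_derive; [exact I | field; lra].
  + replace (((exp (r * t) + exp (- (r * t))) / 2) ^ 2
      - r * r * ((exp (r * t) - exp (- (r * t))) / (2 * r)) ^ 2)
      with (exp (r * t) * exp (- (r * t))) by (field; lra).
    rewrite <- exp_plus, Rplus_opp_r; apply exp_0.
Qed.

(** With [m = m1 + i m2] the hypotheses read [X' = m X] and [Y' = m Y], so the complex quotient
    [X / Y] has derivative 0; its two coordinates are treated as real functions. *)
Lemma parallel_solutions_ratio (X1 X2 Y1 Y2 m1 m2 : R -> R) (t : R) :
  0 < t ->
  (forall s, 0 <= s <= t ->
     is_derive X1 s (m1 s * X1 s - m2 s * X2 s) /\
     is_derive X2 s (m1 s * X2 s + m2 s * X1 s) /\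
     is_derive Y1 s (m1 s * Y1 s - m2 s * Y2 s) /\
     is_derive Y2 s (m1 s * Y2 s + m2 s * Y1 s) /\
     Y1 s ^ 2 + Y2 s ^ 2 <> 0) ->
  ((X1 t, X2 t) / (Y1 t, Y2 t) = (X1 0, X2 0) / (Y1 0, Y2 0))%C.
Proof.
intros Ht H.
assert (D : forall s, ((X1 s, X2 s) / (Y1 s, Y2 s))%C =
  ((X1 s * Y1 s + X2 s * Y2 s) / (Y1 s ^ 2 + Y2 s ^ 2),
   (X2 s * Y1 s - X1 s * Y2 s) / (Y1 s ^ 2 + Y2 s ^ 2))).
{ intros s; apply injective_projections; simpl; unfold Rdiv; ring. }
rewrite !D; symmetry; f_equal.
- apply (eq_is_derive (fun s => (X1 s * Y1 s + X2 s * Y2 s)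
    / (Y1 s ^ 2 + Y2 s ^ 2)) 0 t); [|exact Ht].
  intros s Hs; destruct (H s Hs) as (DX1 & DX2 & DY1 & DY2 & N).
  auto_derive.
  + repeat split; try (eexists; eassumption).
    intros E; apply N; rewrite <- E; ring.
  + rewrite (is_derive_unique _ _ _ DX1 : Derive (fun x => X1 x) s = _).
    rewrite (is_derive_unique _ _ _ DX2 : Derive (fun x => X2 x) s = _).
    rewrite (is_derive_unique _ _ _ DY1 : Derive (fun x => Y1 x) s = _).
    rewrite (is_derive_unique _ _ _ DY2 : Derive (fun x => Y2 x) s = _).
    unfold zero; simpl; field.
    intros E; apply N; rewrite <- E; ring.
- apply (eq_is_derive (fun s => (X2 s * Y1 s - X1 s * Y2 s)
    / (Y1 s ^ 2 + Y2 s ^ 2)) 0 t); [|exact Ht].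
  intros s Hs; destruct (H s Hs) as (DX1 & DX2 & DY1 & DY2 & N).
  auto_derive.
  + repeat split; try (eexists; eassumption).
    intros E; apply N; rewrite <- E; ring.
  + rewrite (is_derive_unique _ _ _ DX1 : Derive (fun x => X1 x) s = _).
    rewrite (is_derive_unique _ _ _ DX2 : Derive (fun x => X2 x) s = _).
    rewrite (is_derive_unique _ _ _ DY1 : Derive (fun x => Y1 x) s = _).
    rewrite (is_derive_unique _ _ _ DY2 : Derive (fun x => Y2 x) s = _).
    unfold zero; simpl; field.
    intros E; apply N; rewrite <- E; ring.
Qed.

(* The Riccati equation is linearised by the matrix
   [A = [[i b / 2, a], [conj a, - i b / 2]]], and
   [exp (t A) = [[u, v], [conj v, conj u]]].  Along a solution [w] the
   numerator and the denominator of the inverse Moebius map satisfy the same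
   scalar linear equation, so that their quotient is constant. *)
Lemma riccati_flow_mobius (a : C) (b : R) :
  exists U V : R -> C, (forall t, Cmod (V t) < Cmod (U t)) /\
    forall w : R -> C,
      (forall t, 0 <= t -> unit_disk (w t) /\
         is_derive_nonneg w t
           (a - Cconj a * (w t * w t) + Ci * b * w t)%C) ->
      forall t, 0 <= t -> w t = mobius (U t) (V t) (w 0).
Proof.
destruct a as [p q].
(* [A] has trace 0, hence [A ^ 2 = lambda] with [lambda = - det A = |a|^2 - b^2 / 4]. *)
destruct (exp_coefficients (p ^ 2 + q ^ 2 - b ^ 2 / 4))
  as (c & s & c0 & s0 & Dc & Ds & I1).
set (U := fun t => (c t, s t * b / 2) : C).
set (V := fun t => (s t * p, s t * q) : C).
assert (HUV : forall t, Cmod (V t) < Cmod (U t)).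
{ intros t; apply Cmod_lt_of_sqr; rewrite !Cmod2_alt.
  unfold U, V, Re, Im; simpl.
  specialize (I1 t); simpl in I1; lra. }
exists U, V; split; [exact HUV|].
intros w Hw t Ht.
assert (HUV' : forall r, Cmod (- V r) < Cmod (Cconj (U r)))
  by (intros r; rewrite Cmod_opp, Cmod_conj; apply HUV).
destruct (is_derive_nonneg_coordinates w _ (fun t Ht => proj2 (Hw t Ht)))
  as (x & y & Ew & Dw).
assert (E0 : forall z, mobius (Cconj (U 0)) (- V 0) z = z).
{ intros z; unfold U, V; rewrite c0, s0.
  replace (1, 0 * b / 2) with (RtoC 1)
    by (unfold RtoC; f_equal; field).
  replace (0 * p, 0 * q) with (RtoC 0) by (unfold RtoC; f_equal; ring).
  assert (Cj : forall r : R, Cconj r = r)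
    by (intros r; unfold Cconj, RtoC; simpl; f_equal; ring).
  unfold mobius; rewrite Copp_conj, !Cj; field. }
destruct (Req_dec t 0) as [T0|T0].
{ subst t; rewrite <- (E0 (w 0)) at 2.
  symmetry; apply mobius_inverse_l; [apply HUV | apply Hw, Ht]. }
assert (K : mobius (Cconj (U t)) (- V t) (w t) = w 0).
{ rewrite <- (E0 (w 0)).
  set (X1 := fun r => c r * x r + s r * b / 2 * y r - s r * p).
  set (X2 := fun r => c r * y r - s r * b / 2 * x r - s r * q).
  set (Y1 := fun r => c r - s r * (p * x r + q * y r)).
  set (Y2 := fun r => s r * b / 2 - s r * (p * y r - q * x r)).
  assert (EX : forall r, 0 <= r ->
    (Cconj (U r) * w r + - V r)%C = (X1 r, X2 r)).
  { intros r Hr; rewrite (Ew r Hr); unfold U, V, X1, X2.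
    apply injective_projections; simpl; field. }
  assert (EY : forall r, 0 <= r ->
    (Cconj (- V r) * w r + Cconj (Cconj (U r)))%C = (Y1 r, Y2 r)).
  { intros r Hr; rewrite (Ew r Hr); unfold U, V, Y1, Y2.
    apply injective_projections; simpl; field. }
  unfold mobius; rewrite !EX, !EY by lra.
  (* The common multiplier is [i b / 2 - conj a w], split into its real and imaginary parts. *)
  apply (parallel_solutions_ratio X1 X2 Y1 Y2
    (fun r => - (p * x r + q * y r))
    (fun r => - (p * y r - q * x r - b / 2))); [lra|].
  intros r Hr.
  assert (Hr0 : 0 <= r) by lra.
  destruct (Dw r Hr0) as [Dx Dy]; rewrite (Ew r Hr0) in Dx, Dy.
  pose proof (is_derive_unique _ _ _ Dx : Derive (fun x0 => x x0) r = _) as Ux.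
  pose proof (is_derive_unique _ _ _ Dy : Derive (fun x0 => y x0) r = _) as Uy.
  pose proof (is_derive_unique _ _ _ (Dc r)
    : Derive (fun x0 => c x0) r = _) as Uc.
  pose proof (is_derive_unique _ _ _ (Ds r)
    : Derive (fun x0 => s x0) r = _) as Us.
  assert (Ex : ex_derive x r) by (eexists; exact Dx).
  assert (Ey : ex_derive y r) by (eexists; exact Dy).
  assert (Ec : ex_derive c r) by (eexists; apply Dc).
  assert (Es : ex_derive s r) by (eexists; apply Ds).
  split; [|split; [|split; [|split]]].
  - unfold X1, X2; auto_derive; [repeat split; assumption|].
    rewrite Ux, Uy, Uc, Us; unfold Re, Im; simpl; field.
  - unfold X1, X2; auto_derive; [repeat split; assumption|].
    rewrite Ux, Uy, Uc, Us; unfold Re, Im; simpl; field.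
  - unfold Y1, Y2; auto_derive; [repeat split; assumption|].
    rewrite Ux, Uy, Uc, Us; unfold Re, Im; simpl; field.
  - unfold Y1, Y2; auto_derive; [repeat split; assumption|].
    rewrite Ux, Uy, Us; unfold Re, Im; simpl; field.
  - pose proof (mobius_denom_neq_0 _ _ (w r) (HUV' r)
      (proj1 (Hw r Hr0))) as N.
    rewrite (EY r Hr0) in N.
    intros E; apply N; apply injective_projections; simpl; nra. }
rewrite <- K; symmetry.
apply mobius_inverse_l; [apply HUV | apply Hw, Ht].
Qed.

(** Agreement inside the disk is enough: the disk is open, so derivatives carry over, and the same
    inverse serves. *)
Lemma disk_automorphism_ext (f g : C -> C) :
  (forall z, unit_disk z -> f z = g z) ->
  disk_automorphism f -> disk_automorphism g.
Proof.
intros E (B & Hf & h & Bh & Hh & hf & fh).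
split; [|split; [|exists h; split; [|split; [|split]]]].
- intros z Hz; rewrite <- E by exact Hz; apply B, Hz.
- intros z Hz; destruct (holomorphic_cderive _ f z Hf Hz) as [d Hd].
  exists d; apply (is_cderive_ext f g z d (1 - Cmod z)); [|intros w Hw|exact Hd].
  + unfold unit_disk in Hz; lra.
  + apply E, (unit_disk_open z); assumption.
- exact Bh.
- exact Hh.
- intros z Hz; rewrite <- E by exact Hz; apply hf, Hz.
- intros z Hz; rewrite <- E by (apply Bh, Hz); apply fh, Hz.
Qed.

Lemma vector_field_holomorphic (p : C -> C) (k : R) :
  holomorphic_on unit_disk p -> holomorphic_on unit_disk (vector_field p k).
Proof.
intros Hp w Hw; destruct (holomorphic_cderive _ p w Hp Hw) as [d Hd].
eexists.
apply (is_cderive_ext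
  (fun w => (w + - (1)) * (w + - (1)) * p w + (- (Ci * k)) * w)%C _ w _ 1);
  [lra | intros z _; unfold vector_field; simpl; ring |].
apply is_cderive_plus.
- apply (is_cderive_mult (fun w => (w + - (1)) * (w + - (1)))%C); [|exact Hd].
  apply is_cderive_mult; apply is_cderive_plus;
    apply is_cderive_id || apply is_cderive_const.
- apply is_cderive_mult; [apply is_cderive_const | apply is_cderive_id].
Qed.

Theorem proposition1 (p : C -> C)
  (p_holo : holomorphic_on unit_disk p)
  (p_Re : forall z : C, unit_disk z -> (0 <= Re (p z))%R)
  (k0 : R) (psi0 : R -> C -> C)
  (psi0_semigroup : is_semigroup_of p k0 psi0)
  (psi0_auto : family_of_automorphisms psi0) :
  forall (k : R) (psi : R -> C -> C),
    is_semigroup_of p k psi -> family_of_automorphisms psi.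
Proof.
intros k psi Hpsi t Ht.
destruct (automorphic_generator_form (vector_field p k0) psi0
  (vector_field_holomorphic p k0 p_holo) psi0_semigroup psi0_auto)
  as (a & b & HG).
(* Replacing [k0] by [k] adds [i (k0 - k) w] to the vector field, so the coefficient [b] becomes
   [b + k0 - k] while [a] is kept. *)
destruct (riccati_flow_mobius a (b + k0 - k)) as (U & V & HUV & Hflow).
apply disk_automorphism_ext with (mobius (U t) (V t));
  [|apply mobius_automorphism, HUV].
intros z Hz; destruct (Hpsi z Hz) as [E0 D].
rewrite (Hflow (fun s => psi s z)) with (t := t).
- rewrite E0; reflexivity.
- intros s Hs; destruct (D s Hs) as [Ds Dd]; split; [exact Ds|].
  replace (a - Cconj a * (psi s z * psi s z)
           + Ci * (b + k0 - k)%R * psi s z)%C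
    with (vector_field p k (psi s z)); [exact Dd|].
  pose proof (HG _ Ds) as E.
  replace (vector_field p k (psi s z))
    with (vector_field p k0 (psi s z) + Ci * (k0 - k)%R * psi s z)%C.
  + rewrite E, !RtoC_minus, RtoC_plus; ring.
  + unfold vector_field; rewrite RtoC_minus; ring.
- exact Ht.
Qed.
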